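(* Let $n,N\ge1$ and consider the nonlinearly coupled network $$\dot x_i=f_i(t,x_i)-c\sum_{j=1}^Na_{ij}\,\eta(t,x_i-x_j),\qquad i=1,\dots,N,$$ on a connected undirected weighted graph, with $x_i\in\mathbb R^n$. Assume each $f_i=h_i+g_i$ is a QUAD$(I_n,W_i)$ Affine (continuous or piecewise smooth) vector field such that: (a) $h_i$ is QUAD$(I_n,W_i)$ with $W_i$ diagonal and $W_i<0$, and $\|\tilde g_i(t,x)\|_2<M_i<+\infty$ for all $\tilde g_i(t,x)\in\mathcal F[g_i](t,x)$, $t\in\mathbb R^+$, $x\in\mathbb R^n$, $i=1,\dots,N$; (b) there is $\bar h_0<+\infty$ with $\sup_{t\ge0,\ i=1,\dots,N}\|\tilde h_i(t,0)\|_2\le\bar h_0$ for all $\tilde h_i(t,0)\in\mathcal F[h_i](t,0)$. Assume the (possibly discontinuous) coupling function $\eta:\mathbb R^+\times\mathbb R^n\to\mathbb R^n$ is component-wise odd, $\eta(t,-v)=-\eta(t,v)$, and that for some $e_{\max}>0$ and some diagonal $\Upsilon=\mathrm{diag}\{\upsilon_i\}_{i=1}^n$ with $\upsilon_i>0$ for $i\le r$ and $\upsilon_i=0$ for $i>r$ ($1\le r\le n$), $$z^T\tilde\eta(t,z)\ge z^T\Upsilon z\qquad\forall t\in\mathbb R^+,\ \forall z:\|z\|_2\le e_{\max},\ \forall\tilde\eta(t,z)\in\mathcal F[\eta](t,z).$$ Let $\overline M=\max_iM_i$, $w_{\max}=\max_i\lambda_{\max}(W_i)$, let $W^{\max}$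 be the diagonal matrix whose $j$-th diagonal entry is $\max_i(W_i)_{jj}$, let $\delta>0$ be an arbitrarily small scalar, and set $$\bar\epsilon_1=-\frac{\sqrt N(\overline M+\bar h_0)}{w_{\max}},\qquad r_{\max}=\max\{\bar\epsilon_1,\|x(0)\|_2\}+\delta,$$ $$h_{\max}=\max\{\|\tilde h_i(t,z)\|_2:\ i=1,\dots,N,\ z\in\mathbb R^n,\ \|z\|_2\le r_{\max},\ t\in[0,+\infty),\ \tilde h_i(t,z)\in\mathcal F[h_i](t,z)\},$$ and suppose $h_{\max}<+\infty$. If (i) the initial error satisfies $\|e(0)\|_2\le e_{\max}/2$; (ii) $\displaystyle-\frac{\sqrt N(\overline M+h_{\max})}{\lambda_{\max}(W^{\max}_{n-r})}<\frac{e_{\max}}2$; then the network achieves $\epsilon$-bounded convergence if the coupling gain $c$ is chosen greater than $$\tilde c=\max\left\{\frac1{\lambda_2(L\otimes\Upsilon_r)}\left(\frac{2\sqrt N(\overline M+h_{\max})}{e_{\max}}+\lambda_{\max}(W^{\max}_r)\right),0\right\}.$$ Furthermore, an upper bound on $\epsilon$ is $$\bar\epsilon=\min\left\{\bar\epsilon_1,\ \bar\epsilon_2=\frac{\sqrt N(\overline M+h_{\max})}{m(c,W^{\max})}\right\},\qquad m(c,W^{\max})=-\max\{\lambda_{\max}(W^{\max}_r)-c\,\lambda_2(L\otimes\Upsilon_r),\ \lambda_{\max}(W^{\max}_{n-r})\},$$ i.e. the network achieves $\epsilon$-bounded convergence with $\epsilon=\bar\epsilon$.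
   Context: **Notation.** $\mathbb R^+=[0,+\infty)$. $W<0$ means negative definite. $\|\cdot\|_2$ is the Euclidean norm. $\lambda_{\max}(M)$ is the largest eigenvalue of $M$. $I_n$ is the identity. The subscript $r$ on a diagonal matrix denotes its $r\times r$ upper-left block and $n-r$ its $(n-r)\times(n-r)$ lower-right block (terms and conditions involving an empty block are omitted). **Piecewise smooth (PWS) vector fields.** $f:\mathbb R^+\times\mathbb R^n\to\mathbb R^n$ is PWS if there are finitely many disjoint open nonempty sets $\mathcal S_1,\dots,\mathcal S_p$ whose closures cover $\mathbb R^n$, each intersection $\bar{\mathcal S}_h\cap\bar{\mathcal S}_k$ ($h\neq k$) being either an $(n-1)$-dimensional manifold or empty, with $f(t,x)=F_k(t,x)$ for $x\in\mathcal S_k$, where each $F_k$ is smooth in $t$ and in $x\in\mathcal S_k$ and is continuously extended to $\partial\mathcal S_k$. The Filippov set-valued map is $$\mathcal F[f](t,x)=\bigcap_{\delta>0}\ \bigcap_{m(\mathcal S)=0}\overline{\mathrm{co}}\{f(t,B_\delta(x)\setminus\mathcal S)\},$$ with $m(\cdot)$ here Lebesgue measure, $B_\delta(x)$ the open ball and $\overline{\mathrm{co}}$ the closed convex hull. If $f$ is continuous at $(t,x)$ then $\mathcal F[f](t,x)=\{f(t,x)\}$. The coupling $\eta$ is continuous or PWS. Solutions of $\dot x=f(t,x)$ are Filippov solutions: absolutely continuous $x(t)$ with $\dot x(t)\in\mathcal F[f](t,x(t))$ for almost all $t$. The network is understood in this sense, as a system in $\mathbb R^{Nn}$ with state $x=[x_1^T,\dots,x_N^T]^T$.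 **QUAD.** For $P$ positive definite diagonal and $W$ diagonal, $f$ is QUAD$(P,W)$ if $(x-y)^TP[\tilde f(t,x)-\tilde f(t,y)]\le(x-y)^TW(x-y)$ for all $x,y\in\mathbb R^n$, $t\in\mathbb R^+$, $\tilde f(t,x)\in\mathcal F[f](t,x)$, $\tilde f(t,y)\in\mathcal F[f](t,y)$. $f$ is QUAD$(P,W)$ Affine if $f=h+g$ with $h$ continuous or PWS and QUAD$(P,W)$, and $g$ continuous or PWS such that for some $M<+\infty$, $\|\tilde g(t,x)\|_2<M$ for all $x,t$ and all $\tilde g(t,x)\in\mathcal F[g](t,x)$. **Graph.** $a_{ij}=a_{ji}\ge0$, positive iff $\{i,j\}$ is an edge ($i\ne j$). The Laplacian $L=[\ell_{ij}]$ has $\ell_{ij}=-a_{ij}$ for $i\neq j$ and $\ell_{ii}=\sum_{k\ne i}a_{ik}$. $\lambda_2(L)$ is its smallest nonzero eigenvalue. For a positive definite diagonal matrix $D$, $\lambda_2(L\otimes D)$ is the smallest nonzero eigenvalue of $L\otimes D$, i.e. $\lambda_2(L)\min_iD_{ii}$. **$\epsilon$-bounded convergence.** Let $\bar x=\frac1N\sum_jx_j$, $e_i=x_i-\bar x$, $e=[e_1^T,\dots,e_N^T]^T$. The network achieves $\epsilon$-bounded convergence if ''$\lim_{t\to\infty}\|e(t)\|_2\le\epsilon$'' in the sense that (along its trajectories from the given initial condition) for all $\nu>0$ there is $t_\nu>0$ such that $\|e(t)\|_2\le\epsilon+\nu$ for all $t>t_\nu$.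
   Formalization: Piecewise smooth is taken to include that the complement of the union of the regions S_k has Lebesgue measure zero; without this the field is arbitrary on a set of positive measure and the claim can fail (e.g. an unbounded coupling there). *)

(* Defs.v *)
(* Vectors of R^n are row vectors 'rV[R]_n, so x^T A y reads x *m A *m y^T;
   the topology of 'rV[R]_n is the library's (the usual one of R^n). *)
From HB Require Import structures.
From mathcomp Require Import all_boot all_order all_algebra.
From mathcomp Require Import all_classical all_reals all_analysis.
From mathcomp Require Import mxtens.

Set Implicit Arguments.
Unset Strict Implicit.
Unset Printing Implicit Defensive.

Import Order.TTheory GRing.Theory Num.Theory.
Import numFieldNormedType.Exports.

Local Open Scope classical_set_scope.
Local Open Scope ring_scope.

Section Vectors.
Variable R : realType.

(* The library norm `|x| on 'rV[R]_n is the sup norm. *)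
Definition norm2 (n : nat) (x : 'rV[R]_n) : R :=
  Num.sqrt (\sum_j x 0 j ^+ 2).

Definition ball2 (n : nat) (x : 'rV[R]_n) (d : R) : set 'rV[R]_n :=
  [set y | norm2 (y - x) < d].

(* x^T A y *)
Definition bform (n : nat) (A : 'M[R]_n) (x y : 'rV[R]_n) : R :=
  (x *m A *m y^T) 0 0.

Definition negdef (n : nat) (A : 'M[R]_n) : Prop :=
  forall x : 'rV[R]_n, x != 0 -> bform A x x < 0.

(* For a nonempty I, the supremum is the maximum. *)
Definition maxf (I : finType) (f : I -> R) : R := sup (range f).

Definition lambda_max (n : nat) (A : 'M[R]_n) : R :=
  sup [set a | eigenvalue A a].

(* Smallest nonzero eigenvalue of a matrix with finitely many real eigenvalues;
   it is 0 (= inf set0) if there is none, e.g. for the Laplacian of a graph with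
   a single vertex. *)
Definition lambda2 (n : nat) (A : 'M[R]_n) : R :=
  inf [set a | eigenvalue A a /\ a != 0].

End Vectors.

Section Filippov.
Variable R : realType.

(* Lebesgue outer measure of R^n, by countable covers by compact boxes. *)
Definition box (n : nat) (a b : 'rV[R]_n) : set 'rV[R]_n :=
  [set x | forall j, a 0 j <= x 0 j <= b 0 j].

Definition outer_measure (n : nat) (A : set 'rV[R]_n) : \bar R :=
  ereal_inf [set s | exists a b : nat -> 'rV[R]_n,
    [/\ forall k j, a k 0 j <= b k 0 j,
        A `<=` \bigcup_k box (a k) (b k) &
        s = (\sum_(0 <= k <oo) (\prod_j (b k 0 j - a k 0 j))%:E)%E]].

Definition null_set (n : nat) (A : set 'rV[R]_n) : Prop :=
  outer_measure A = 0%E.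

Definition convex_hull (n : nat) (A : set 'rV[R]_n) : set 'rV[R]_n :=
  smallest (@convex_set R 'rV[R]_n) A.

Definition filippov (n : nat) (f : R -> 'rV[R]_n -> 'rV[R]_n)
    (t : R) (x : 'rV[R]_n) : set 'rV[R]_n :=
  \bigcap_(d in [set d | 0 < d]) \bigcap_(S in @null_set n)
    closure (convex_hull (f t @` (ball2 x d `\` S))).

Definition absolutely_continuous_on (n : nat) (a b : R)
    (x : R -> 'rV[R]_n) : Prop :=
  forall e : R, 0 < e -> exists2 d : R, 0 < d &
    forall (m : nat) (u v : 'I_m -> R),
      (forall k, a <= u k /\ u k <= v k /\ v k <= b) ->
      trivIset setT (fun k => `]u k, v k[%classic) ->
      \sum_k (v k - u k) < d ->
      \sum_k norm2 (x (v k) - x (u k)) < e.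

(* Solutions on [0, +oo) of x' = f(t, x); the values of x at negative times are
   irrelevant. *)
Definition filippov_solution (n : nat) (f : R -> 'rV[R]_n -> 'rV[R]_n)
    (x : R -> 'rV[R]_n) : Prop :=
  (forall T : R, 0 <= T -> absolutely_continuous_on 0 T x) /\
  {ae (@lebesgue_measure R), forall t : R, 0 <= t ->
     derivable x t 1 /\ filippov f t (x t) (derive1 x t)}.

End Filippov.

Section PWS.
Variable R : realType.

Fixpoint Ck_on (V : normedModType R) (k : nat) (U : set V) (g : V -> R) : Prop :=
  {within U, continuous g} /\
  if k is k'.+1 then
    forall v : V, (forall p, U p -> derivable g p v) /\ Ck_on k' U ('D_v g)
  else True.

(* C^oo on a possibly non-open set A (here R^+ x S_k, which has the boundary
   t = 0): g extends, locally around each point of A, to a C^oo function on an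
   open set. *)
Definition smooth_on (V : normedModType R) (A : set V) (g : V -> R) : Prop :=
  forall p, A p -> exists (U : set V) (g' : V -> R),
    [/\ open U, U p, forall q, A q -> U q -> g' q = g q &
        forall k, Ck_on k U g'].

(* A, with the subspace topology, is locally homeomorphic to R^d (it is
   Hausdorff and second countable, as a subspace of R^n). *)
Definition is_manifold (n d : nat) (A : set 'rV[R]_n) : Prop :=
  forall x, A x -> exists (U : set 'rV[R]_n) (V : set 'rV[R]_d)
      (phi : 'rV[R]_n -> 'rV[R]_d) (psi : 'rV[R]_d -> 'rV[R]_n),
    [/\ [/\ open U, U x & open V],
        phi @` (A `&` U) = V /\ psi @` V = A `&` U,
        (forall y, (A `&` U) y -> psi (phi y) = y) /\
        (forall z, V z -> phi (psi z) = z) &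
        {within A `&` U, continuous phi} /\ {within V, continuous psi}].

Definition continuous_vf (n : nat) (f : R -> 'rV[R]_n -> 'rV[R]_n) : Prop :=
  {within [set p : R^o * 'rV[R]_n | 0 <= p.1],
     continuous (fun p : R^o * 'rV[R]_n => f p.1 p.2)}.

(* The values of f on the switching set ~` \bigcup_k S k are unconstrained. That
   this set is Lebesgue null is part of the notion: the Filippov map ignores f
   there. It is not implied by the other clauses, which allow a single region S
   whose complement is closed, nowhere dense and of positive measure. *)
Definition pws (n : nat) (f : R -> 'rV[R]_n -> 'rV[R]_n) : Prop :=
  exists (p : nat) (S : 'I_p -> set 'rV[R]_n)
         (F : 'I_p -> R -> 'rV[R]_n -> 'rV[R]_n),
    [/\ [/\ forall k, open (S k), forall k, S k !=set0 & trivIset setT S],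
        \bigcup_k closure (S k) = setT,
        null_set (~` \bigcup_k S k),
        forall h k, h != k ->
          closure (S h) `&` closure (S k) = set0 \/
          is_manifold n.-1 (closure (S h) `&` closure (S k)) &
        forall k,
          [/\ forall j : 'I_n,
                smooth_on [set q : R^o * 'rV[R]_n | 0 <= q.1 /\ S k q.2]
                          (fun q => F k q.1 q.2 0 j),
              {within [set q : R^o * 'rV[R]_n | 0 <= q.1 /\ closure (S k) q.2],
                 continuous (fun q : R^o * 'rV[R]_n => F k q.1 q.2)} &
              forall t x, 0 <= t -> S k x -> f t x = F k t x]].

Definition continuous_or_pws (n : nat) (f : R -> 'rV[R]_n -> 'rV[R]_n) : Prop :=
  continuous_vf f \/ pws f.

Definition quad (n : nat) (P W : 'M[R]_n) (f : R -> 'rV[R]_n -> 'rV[R]_n)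
    : Prop :=
  forall (x y : 'rV[R]_n) (t : R) (fx fy : 'rV[R]_n), 0 <= t ->
    filippov f t x fx -> filippov f t y fy ->
    bform P (x - y) (fx - fy) <= bform W (x - y) (x - y).

(* f = h + g is a QUAD(P, W) Affine vector field, with this decomposition and
   this bound M on g. *)
Definition quad_affine (n : nat) (P W : 'M[R]_n)
    (f h g : R -> 'rV[R]_n -> 'rV[R]_n) (M : R) : Prop :=
  [/\ forall t x, 0 <= t -> f t x = h t x + g t x,
      continuous_or_pws h, continuous_or_pws g, quad P W h &
      forall t x v, 0 <= t -> filippov g t x v -> norm2 v < M].

End PWS.

Section Network.
Variable R : realType.

Definition weights (N : nat) (a : 'M[R]_N) : Prop :=
  (forall i j, 0 <= a i j) /\ (forall i j, a i j = a j i).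

Definition edge (N : nat) (a : 'M[R]_N) : rel 'I_N :=
  [rel i j | (i != j) && (0 < a i j)].

Definition graph_connected (N : nat) (a : 'M[R]_N) : Prop :=
  forall i j, connect (edge a) i j.

Definition laplacian (N : nat) (a : 'M[R]_N) : 'M[R]_N :=
  \matrix_(i, j) if i == j then \sum_(k | k != i) a i k else - a i j.

(* The state [x_1^T, ..., x_N^T]^T of R^{Nn} is stored as mxvec X, where X is the
   N x n matrix with rows x_1, ..., x_N; thus x_i is row i (vec_mx x). *)
Definition node (N n : nat) (x : 'rV[R]_(N * n)) (i : 'I_N) : 'rV[R]_n :=
  row i (vec_mx x).

Definition stack (N n : nat) (y : 'I_N -> 'rV[R]_n) : 'rV[R]_(N * n) :=
  mxvec (\matrix_i y i).

Definition network (N n : nat) (f : 'I_N -> R -> 'rV[R]_n -> 'rV[R]_n)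
    (a : 'M[R]_N) (eta : R -> 'rV[R]_n -> 'rV[R]_n) (c : R)
    (t : R) (x : 'rV[R]_(N * n)) : 'rV[R]_(N * n) :=
  stack (fun i => f i t (node x i)
                  - c *: \sum_j a i j *: eta t (node x i - node x j)).

Definition node_mean (N n : nat) (x : 'rV[R]_(N * n)) : 'rV[R]_n :=
  N%:R^-1 *: \sum_j node x j.

Definition error (N n : nat) (x : 'rV[R]_(N * n)) : 'rV[R]_(N * n) :=
  stack (fun i => node x i - node_mean x).

Definition bounded_convergence (N n : nat) (eps : R)
    (x : R -> 'rV[R]_(N * n)) : Prop :=
  forall nu : R, 0 < nu -> exists2 tnu : R, 0 < tnu &
    forall t, tnu < t -> norm2 (error (x t)) <= eps + nu.

(* The supremum, in [-oo, +oo], defining h_max. *)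
Definition h_sup (N n : nat) (h : 'I_N -> R -> 'rV[R]_n -> 'rV[R]_n) (r : R)
    : \bar R :=
  ereal_sup [set s | exists i z t v,
    [/\ norm2 z <= r, 0 <= t, filippov (h i) t z v & s = (norm2 v)%:E]].

Definition Wmax (N n : nat) (W : 'I_N -> 'M[R]_n) : 'M[R]_n :=
  diag_mx (\row_j maxf (fun i => W i j j)).

(* Blocks: R^n = R^r x R^s with n = r + s. *)
Definition c_threshold (N r s : nat) (a : 'M[R]_N) (Upsilon W : 'M[R]_(r + s))
    (M hmax emax : R) : R :=
  Num.max
    ((lambda2 (laplacian a *t ulsubmx Upsilon))^-1 *
       (2 * Num.sqrt N%:R * (M + hmax) / emax + lambda_max (ulsubmx W)))
    0.

(* m(c, W); the term of the lower-right block is omitted when it is empty. *)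
Definition m_rate (N r s : nat) (a : 'M[R]_N) (Upsilon W : 'M[R]_(r + s))
    (c : R) : R :=
  let m1 := lambda_max (ulsubmx W)
            - c * lambda2 (laplacian a *t ulsubmx Upsilon) in
  - (if s == 0%N then m1 else Num.max m1 (lambda_max (drsubmx W))).

End Network.

(* Main.v *)
Require Import Defs.
From HB Require Import structures.
From mathcomp Require Import all_boot all_order all_algebra.
From mathcomp Require Import all_classical all_reals all_analysis.
From mathcomp Require Import measurable_realfun mxtens ring lra.

Set Implicit Arguments.
Unset Strict Implicit.
Unset Printing Implicit Defensive.

Import Order.TTheory GRing.Theory Num.Theory.
Import numFieldNormedType.Exports.

Local Open Scope classical_set_scope.
Local Open Scope ring_scope.

(** Both bounds come from one differential inequality. Along a Filippov solution x,
    with error e, the squared norms have derivatives 2 <x, v> and 2 <e, v>, where v is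
    a Filippov value of the network field, and
      <x, v> <= wmax |x|^2 + sqrt N (Mbar + h0) |x|,
      <e, v> <= - m |e|^2 + sqrt N (Mbar + hmax) |e|.
    For the first, QUAD compares each node with the point 0. The coupling is odd, so
    it sums to 1/2 sum_ij a_ij <x_i - x_j, eta(x_i - x_j)>, which is nonnegative as
    long as the differences lie in the range of the sector condition. For the second,
    QUAD compares each node with the mean. The sector condition bounds the coupling
    below by the Laplacian form of the first r coordinates, and the form by its
    spectral gap ([laplacian_gap], [lambda2_tens_diag]), so these coordinates decay at
    the rate c lambda2 minus the largest entry of W; the others decay through W alone.
    The minimum of both rates is m ([m_rate_le]).

    An inequality <z, z'> <= - m |z|^2 + k |z| makes the ball of radius k / m
    attracting and all larger balls invariant ([radial_decay_bound],
    [radial_decay_limit]). The estimates hold only while |x| < rmax and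
    |e| < 2/3 emax (then all differences are below emax). Condition (i) and the gain
    condition, with (ii), put the initial state into smaller invariant balls
    ([m_rate_beats]), so the solution never leaves that region ([trapping]), and
    the two attracting balls give the two bounds; |e| <= |x| turns the first into a
    bound on the error.

    Three points need more care. The derivative is known almost everywhere only, so
    monotonicity is derived from absolute continuity ([ac_nonincreasing]). The
    Filippov map of the network is not expressed through those of its constituents.
    Instead, a Filippov value at x lies in every half-space that contains the values
    of the field near x outside some null set ([filippov_halfspace]), and off a
    null set h_i, g_i and eta take Filippov values of their own
    ([piecewise_continuous_filippov], [network_regular]). For this, null sets of R^n
    must have null preimages under the maps x |-> x_i and x |-> x_i - x_j
    ([null_node], [null_node_diff]), and balls must not be null
    ([vol_le_cover]). *)

Local Notation outer_measure := Defs.outer_measure.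
Local Notation null_set := Defs.null_set.

(** * Euclidean norm *)

Section Euclidean.
Variables (R : realType) (n : nat).
Implicit Types (x y z : 'rV[R]_n) (k : R).

Definition dot x y : R := \sum_j x 0 j * y 0 j.

Lemma bform1 x y : bform 1%:M x y = dot x y.
Proof. by rewrite /bform mulmx1 mxE; apply: eq_bigr => j _; rewrite mxE. Qed.

Lemma dotC x y : dot x y = dot y x.
Proof. by apply: eq_bigr => j _; rewrite mulrC. Qed.

Lemma dotDl x y z : dot (x + y) z = dot x z + dot y z.
Proof. by rewrite -big_split; apply: eq_bigr => j _; rewrite mxE mulrDl. Qed.

Lemma dotZl k x z : dot (k *: x) z = k * dot x z.
Proof. by rewrite mulr_sumr; apply: eq_bigr => j _; rewrite mxE mulrA. Qed.

Lemma dotNl x z : dot (- x) z = - dot x z.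
Proof. by rewrite -scaleN1r dotZl mulN1r. Qed.

Lemma dotBl x y z : dot (x - y) z = dot x z - dot y z.
Proof. by rewrite dotDl dotNl. Qed.

Lemma dotDr x y z : dot x (y + z) = dot x y + dot x z.
Proof. by rewrite dotC dotDl ![dot _ x]dotC. Qed.

Lemma dotZr k x z : dot x (k *: z) = k * dot x z.
Proof. by rewrite dotC dotZl dotC. Qed.

Lemma dotNr x z : dot x (- z) = - dot x z.
Proof. by rewrite dotC dotNl dotC. Qed.

Lemma dotBr x y z : dot x (y - z) = dot x y - dot x z.
Proof. by rewrite dotDr dotNr. Qed.

Lemma dot0l y : dot 0 y = 0.
Proof. by apply: big1 => j _; rewrite mxE mul0r. Qed.

Lemma dot_sumr (I : finType) (P : pred I) (F : I -> 'rV[R]_n) x :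
  dot x (\sum_(i | P i) F i) = \sum_(i | P i) dot x (F i).
Proof.
by elim/big_rec2: _ => [|i a b _ <-]; rewrite ?[dot x 0]dotC ?dot0l ?dotDr.
Qed.

Lemma dot_suml (I : finType) (P : pred I) (F : I -> 'rV[R]_n) x :
  dot (\sum_(i | P i) F i) x = \sum_(i | P i) dot (F i) x.
Proof. by rewrite dotC dot_sumr; apply: eq_bigr => i _; rewrite dotC. Qed.

Lemma dotxx_ge0 x : 0 <= dot x x.
Proof. by apply: sumr_ge0 => j _; rewrite -expr2 sqr_ge0. Qed.

Lemma norm2_ge0 x : 0 <= norm2 x.
Proof. exact: sqrtr_ge0. Qed.

Lemma sqr_norm2 x : norm2 x ^+ 2 = dot x x.
Proof.
rewrite sqr_sqrtr; first by apply: eq_bigr => j _; rewrite expr2.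
by apply: sumr_ge0 => j _; rewrite sqr_ge0.
Qed.

Lemma norm2_sqrt_dot x : norm2 x = Num.sqrt (dot x x).
Proof. by rewrite -sqr_norm2 sqrtr_sqr ger0_norm ?norm2_ge0. Qed.

Lemma norm2Z k x : norm2 (k *: x) = `|k| * norm2 x.
Proof.
rewrite norm2_sqrt_dot dotZl dotZr mulrA -expr2 sqrtrM ?sqr_ge0//.
by rewrite sqrtr_sqr -norm2_sqrt_dot.
Qed.

Lemma norm2N x : norm2 (- x) = norm2 x.
Proof. by rewrite -scaleN1r norm2Z normrN1 mul1r. Qed.

Lemma norm2B x y : norm2 (x - y) = norm2 (y - x).
Proof. by rewrite -norm2N opprB. Qed.

Lemma norm20 : norm2 (0 : 'rV[R]_n) = 0.
Proof. by rewrite norm2_sqrt_dot dot0l sqrtr0. Qed.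

Lemma entry_le_norm2 x j : `|x 0 j| <= norm2 x.
Proof.
rewrite -sqrtr_sqr; apply: ler_wsqrtr; rewrite (bigD1 j)//= lerDl.
by apply: sumr_ge0 => i _; rewrite sqr_ge0.
Qed.

Lemma norm2_eq0 x : norm2 x = 0 -> x = 0.
Proof.
move=> x0; apply/rowP => j; apply/eqP; rewrite mxE -normr_le0.
by rewrite (le_trans (entry_le_norm2 x j))// x0.
Qed.

(** Cauchy-Schwarz: expand the nonnegative number |(|y| x - |x| y)|^2. *)
Lemma dot_le_norm2 x y : dot x y <= norm2 x * norm2 y.
Proof.
have [x0|x0] := eqVneq (norm2 x) 0.
  by rewrite (norm2_eq0 x0) norm20 mul0r dot0l.
have [y0|y0] := eqVneq (norm2 y) 0.
  by rewrite (norm2_eq0 y0) norm20 mulr0 dotC dot0l.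
have xy : 0 < norm2 x * norm2 y by rewrite mulr_gt0// lt0r ?x0 ?y0 norm2_ge0.
have := dotxx_ge0 (norm2 y *: x - norm2 x *: y).
rewrite dotBl !dotBr !dotZl !dotZr -!sqr_norm2 (dotC y x).
set a := norm2 x in xy *; set b := norm2 y in xy *; set d := dot x y => H.
have : 0 <= (2 * (a * b)) * (a * b - d) by lra.
by rewrite pmulr_rge0 ?subr_ge0// mulr_gt0.
Qed.

Lemma ler_norm2D x y : norm2 (x + y) <= norm2 x + norm2 y.
Proof.
rewrite -(@ler_pXn2r _ 2)// ?nnegrE ?addr_ge0 ?norm2_ge0//.
rewrite sqr_norm2 dotDl !dotDr (dotC y x) -!sqr_norm2.
have := dot_le_norm2 x y; nra.
Qed.

Lemma ler_norm2B x y : norm2 x - norm2 y <= norm2 (x - y).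
Proof. by rewrite lerBlDr -{1}(subrK y x) ler_norm2D. Qed.

Lemma ler_dist_norm2 x y : `|norm2 x - norm2 y| <= norm2 (x - y).
Proof.
by rewrite ler_norml lerNl opprB ler_norm2B norm2B ler_norm2B.
Qed.

Lemma ler_norm_norm2 x : `|x| <= norm2 x.
Proof.
rewrite [leLHS]/Num.norm/= mx_normrE; apply: bigmax_le => [|[i j] _ /=].
  exact: norm2_ge0.
by rewrite (ord1 i) entry_le_norm2.
Qed.

Lemma ler_entry_norm x j : `|x 0 j| <= `|x|.
Proof.
rewrite [leRHS]/Num.norm/= mx_normrE.
exact: (@le_bigmax _ _ _ _ (fun i : 'I_1 * 'I_n => `|x i.1 i.2|) (0, j)).
Qed.

Lemma norm2_le_bound x k : 0 <= k -> (forall j, `|x 0 j| <= k) ->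
  norm2 x <= n%:R * k.
Proof.
move=> k0 xk.
have nk : 0 <= n%:R * k by rewrite mulr_ge0.
rewrite -(ger0_norm nk) -sqrtr_sqr ler_wsqrtr//.
apply: (@le_trans _ _ (\sum_(j < n) k ^+ 2)).
  apply: ler_sum => j _; rewrite -real_normK ?num_real//.
  by rewrite ler_pXn2r ?nnegrE.
rewrite sumr_const card_ord -[leLHS]mulr_natl exprMn ler_wpM2r ?sqr_ge0//.
by rewrite -natrX ler_nat; case: (n) => // m; rewrite expnS expn1 leq_pmulr.
Qed.

Lemma norm2_le_norm x : norm2 x <= n%:R * `|x|.
Proof. by apply: norm2_le_bound => // j; exact: ler_entry_norm. Qed.

Lemma nbhs_ball2 x (d : R) : 0 < d -> nbhs x (ball2 x d).
Proof.
move=> d0; have n1 : (0 : R) < n%:R + 1 by rewrite ltr_wpDl.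
apply/nbhs_ballP; exists (d / (n%:R + 1)); first by rewrite /= divr_gt0.
move=> y; rewrite -ball_normE /= distrC => yx.
rewrite /ball2 /=; apply: le_lt_trans (norm2_le_norm _) _.
apply: (@le_lt_trans _ _ ((n%:R + 1) * `|y - x|)).
  by rewrite ler_wpM2r// lerDl.
by move: yx; rewrite ltr_pdivlMr// mulrC.
Qed.

Lemma ball2_nbhs x (A : set 'rV[R]_n) : nbhs x A ->
  exists2 d : R, 0 < d & ball2 x d `<=` A.
Proof.
move=> /nbhs_ballP[d /= d0 dA]; exists d => // y yx; apply: dA.
rewrite -ball_normE /= distrC; exact: le_lt_trans (ler_norm_norm2 _) yx.
Qed.

End Euclidean.

(** * Null sets of R^n *)

Section NullSets.
Variable R : realType.

Definition vol n (a b : 'rV[R]_n) : R := \prod_j (b 0 j - a 0 j).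

Lemma vol_ge0 n (a b : 'rV[R]_n) : (forall j, a 0 j <= b 0 j) -> 0 <= vol a b.
Proof. by move=> ab; apply: prodr_ge0 => j _; rewrite subr_ge0. Qed.

Lemma vol_refl n (a : 'rV[R]_n) : (0 < n)%N -> vol a a = 0.
Proof.
by case: n a => // n a _; rewrite /vol (bigD1 ord0)//= subrr mul0r.
Qed.

Lemma outer_measure_nneg n (A : set 'rV[R]_n) : (0 <= outer_measure A)%E.
Proof.
apply: le_ereal_inf_tmp => s [a [b [ab _ ->]]].
by apply: nneseries_ge0 => k _ _; rewrite lee_fin; exact: vol_ge0.
Qed.

(** Covers may be indexed by any countable type: codes of no index carry a
    degenerate box, whose volume is 0 as n > 0. *)
Lemma outer_measure_le_esum n (T : countType) (a b : T -> 'rV[R]_n)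
    (A : set 'rV[R]_n) : (0 < n)%N -> (forall i j, a i 0 j <= b i 0 j) ->
  A `<=` \bigcup_i box (a i) (b i) ->
  (outer_measure A <= \esum_(i in setT) (vol (a i) (b i))%:E)%E.
Proof.
move=> n0 ab Aab.
pose a' k := oapp a 0 (pickle_inv k); pose b' k := oapp b 0 (pickle_inv k).
have ab' k j : a' k 0 j <= b' k 0 j.
  by rewrite /a' /b'; case: pickle_inv => [i|] /=; rewrite ?lexx ?ab.
have -> : \esum_(i in setT) (vol (a i) (b i))%:E =
    (\sum_(0 <= k <oo) (vol (a' k) (b' k))%:E)%E.
  rewrite nneseries_esumT; last by move=> k; rewrite lee_fin; exact: vol_ge0.
  transitivity (\esum_(k in range (@pickle T)) (vol (a' k) (b' k))%:E); last first.
    rewrite esum_mkcond; apply: eq_esum => k _.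
    case: ifPn => // /negP kT; rewrite /a' /b'.
    case E: pickle_inv => [i|/=]; last by rewrite vol_refl.
    case: kT; rewrite inE; exists i => //.
    by move: (@pickle_invK T k); rewrite E.
  rewrite esum_image; last by move=> i j _ _; exact: (pcan_inj (@pickleK T)).
  by apply: eq_esum => i _; rewrite /a' /b' !pickleK_inv.
apply: ereal_inf_lbound; exists a', b'; split => // x /Aab[i _ abx].
by exists (pickle i) => //; rewrite /a' /b' pickleK_inv.
Qed.

Lemma outer_measure_le_finsum n (T : finType) (a b : T -> 'rV[R]_n)
    (A : set 'rV[R]_n) : (0 < n)%N -> (forall i j, a i 0 j <= b i 0 j) ->
  A `<=` \bigcup_i box (a i) (b i) ->
  (outer_measure A <= (\sum_i vol (a i) (b i))%:E)%E.
Proof.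
move=> n0 ab /(outer_measure_le_esum n0 ab) /le_trans; apply.
rewrite (_ : setT = [set` enum T]); last first.
  by apply/seteqP; split=> i _ //=; rewrite mem_enum.
rewrite esum_fset; [|exact: finite_seq|]; last first.
  by move=> i _; rewrite lee_fin; exact: vol_ge0.
by rewrite -fsbig_seq ?enum_uniq//= big_enum/= sumEFin.
Qed.

Lemma outer_measureS n (A B : set 'rV[R]_n) : A `<=` B ->
  (outer_measure A <= outer_measure B)%E.
Proof.
move=> AB; apply: le_ereal_inf => s [a [b [ab Bab ->]]].
by exists a, b; split => //; exact: subset_trans Bab.
Qed.

Lemma sub_null_set n (A B : set 'rV[R]_n) : A `<=` B ->
  null_set B -> null_set A.
Proof.
move=> /outer_measureS + B0; rewrite B0 => A0; apply/eqP.
by rewrite eq_le A0 outer_measure_nneg.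
Qed.

(** The epsilon/2^k argument; the doubly indexed cover that it produces is a cover
    indexed by pairs. *)
Lemma outer_measure_bigcup n (A : nat -> set 'rV[R]_n) : (0 < n)%N ->
  (outer_measure (\bigcup_k A k) <= \sum_(0 <= k <oo) outer_measure (A k))%E.
Proof.
move=> n0; have A0 k := outer_measure_nneg (A k).
have [[k Ak]|Aoo] := pselect (exists k, outer_measure (A k) = +oo%E).
  by rewrite (eseries_pinfty _ _ Ak) ?leey// => i _; rewrite -ltNye
    (lt_le_trans _ (A0 i)).
apply/lee_addgt0Pr => e e0.
apply: le_trans (epsilon_trick _ A0 (ltW e0)).
have /choice[c Hc] k : exists c : (nat -> 'rV[R]_n) * (nat -> 'rV[R]_n),
    [/\ forall i j, c.1 i 0 j <= c.2 i 0 j, A k `<=` \bigcup_i box (c.1 i) (c.2 i)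
     & (\sum_(0 <= i <oo) (vol (c.1 i) (c.2 i))%:E <=
       outer_measure (A k) + (e / (2 ^ k.+1)%:R)%:E)%E].
  have fA : outer_measure (A k) \is a fin_num.
    by rewrite ge0_fin_numE// ltey; apply/eqP => Ak; apply: Aoo; exists k.
  have ek : 0 < e / (2 ^ k.+1)%:R by rewrite divr_gt0// ltr0n expn_gt0.
  have [s [a [b [ab Aab ->]]] /ltW H] := lb_ereal_inf_adherent ek fA.
  by exists (a, b).
apply: (@le_trans _ _ (\esum_(i in [set: nat * nat])
    (vol ((c i.1).1 i.2) ((c i.1).2 i.2))%:E)).
  apply: (@outer_measure_le_esum _ _ (fun i : nat * nat => (c i.1).1 i.2)
    (fun i => (c i.1).2 i.2)) => //.
    by move=> [k i] j; have [+ _ _] := Hc k; apply.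
  move=> x [k _]; have [_ + _] := Hc k => /[apply] -[i _ xi].
  by exists (k, i).
have -> : [set: nat * nat] = [set: nat] `*`` (fun=> [set: nat]).
  by apply/seteqP; split.
have v0 k i : (0 <= (vol ((c k).1 i) ((c k).2 i))%:E)%E.
  by rewrite lee_fin vol_ge0//; have [+ _ _] := Hc k; apply.
rewrite -(esum_esum (a := fun k i => (vol ((c k).1 i) ((c k).2 i))%:E))//.
rewrite nneseries_esumT; last first.
  by move=> k; rewrite adde_ge0// lee_fin divr_ge0// ltW.
apply: le_esum => k _; rewrite -nneseries_esumT//.
by have [_ _] := Hc k.
Qed.

Lemma null_set0 n : (0 < n)%N -> null_set (@set0 'rV[R]_n).
Proof.
move=> n0; apply/eqP; rewrite eq_le outer_measure_nneg andbT.
apply: le_trans (@outer_measure_le_finsum _ void (fun=> 0) (fun=> 0) _ n0 _ _) _ => //.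
by rewrite big1// => -[].
Qed.

Lemma null_bigcup_nat n (A : nat -> set 'rV[R]_n) : (0 < n)%N ->
  (forall k, null_set (A k)) -> null_set (\bigcup_k A k).
Proof.
move=> n0 A0; apply/eqP; rewrite eq_le outer_measure_nneg andbT.
by rewrite (le_trans (outer_measure_bigcup _ n0))// eseries0// => k _ _; exact: A0.
Qed.

Lemma null_bigcup n (T : countType) (A : T -> set 'rV[R]_n) : (0 < n)%N ->
  (forall k, null_set (A k)) -> null_set (\bigcup_k A k).
Proof.
move=> n0 A0; apply: sub_null_set (@null_bigcup_nat n
  (fun k => oapp A set0 (unpickle k)) n0 _).
  by move=> x [i _ Ax]; exists (pickle i) => //; rewrite pickleK.
by move=> k; case: unpickle => [i|/=]; [exact: A0|exact: null_set0].
Qed.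

Lemma null_setU n (A B : set 'rV[R]_n) : (0 < n)%N ->
  null_set A -> null_set B -> null_set (A `|` B).
Proof.
move=> n0 A0 B0.
apply: sub_null_set (@null_bigcup n bool (fun b => if b then A else B) n0 _).
  by move=> x [Ax|Bx]; [exists true|exists false].
by case.
Qed.

End NullSets.

Section BoxVolume.
Variable R : realType.

Definition behead_rV n (x : 'rV[R]_n.+1) : 'rV[R]_n :=
  \row_j x 0 (lift ord0 j).

Lemma vol_recl n (a b : 'rV[R]_n.+1) :
  vol a b = (b 0 0 - a 0 0) * vol (behead_rV a) (behead_rV b).
Proof.
by rewrite /vol big_ord_recl; congr (_ * _); apply: eq_bigr => j _; rewrite !mxE.
Qed.

(** The volume of a box cannot be undercut by a countable cover. Integrating
    over the first coordinate t reduces this to one dimension less: the boxes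
    whose first side contains t cover the slice at t, so the volume of the slice
    is at most the sum of their slice volumes, and Tonelli exchanges the sum
    with the integral. *)
Lemma vol_le_cover n (P : pred nat) (a b : 'rV[R]_n) (u v : nat -> 'rV[R]_n) :
  (forall j, a 0 j <= b 0 j) -> (forall k j, u k 0 j <= v k 0 j) ->
  box a b `<=` \bigcup_(k in [set k | P k]) box (u k) (v k) ->
  ((vol a b)%:E <= \sum_(k <oo | P k) (vol (u k) (v k))%:E)%E.
Proof.
elim: n P a b u v => [|n IH] P a b u v ab uv abuv.
  have [k Pk _] : (\bigcup_(k in [set k | P k]) box (u k) (v k)) a.
    by apply: abuv; case.
  rewrite (@nneseriesD1 _ _ k)//; last by move=> i _; rewrite lee_fin; exact: vol_ge0.
  rewrite /vol !big_ord0 leeDl//; apply: nneseries_ge0 => i _ _.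
  by rewrite lee_fin /vol big_ord0.
pose mu := @lebesgue_measure R.
pose I : set (measurableTypeR R) := `[a 0 0, b 0 0]%classic.
pose J k : set (measurableTypeR R) := `[u k 0 0, v k 0 0]%classic.
have mI : measurable I by exact: measurable_itv.
have mJ k : measurable (J k) by exact: measurable_itv.
pose w k := vol (behead_rV (u k)) (behead_rV (v k)).
have w0 k : 0 <= w k by apply: vol_ge0 => j; rewrite !mxE.
pose h k (t : measurableTypeR R) := ((if P k then w k else 0)%:E * (\1_(J k) t)%:E)%E.
have pw0 k : 0 <= (if P k then w k else 0) by case: ifP.
have h0 k t : (0 <= h k t)%E by rewrite mule_ge0 ?lee_fin.
have mh k : measurable_fun I (h k).
  apply/measurable_funeM/measurable_EFinP; exact: measurable_indic.
have slice t : I t -> ((vol (behead_rV a) (behead_rV b))%:E <= \sum_(k <oo) h k t)%E.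
  move=> It; pose Q k := P k && (t \in J k).
  have -> : (\sum_(k <oo) h k t = \sum_(k <oo | Q k) (w k)%:E)%E.
    rewrite [RHS]eseries_mkcond; apply: eq_eseriesr => k _.
    rewrite /h /Q indicE; case: (P k) => /=; last by rewrite mul0e.
    by case: (t \in J k); rewrite ?mule1 ?mule0.
  apply: IH => [j|k j|x abx]; rewrite ?mxE//.
  pose y : 'rV[R]_n.+1 := \row_j (if unlift ord0 j is Some i then x 0 i else t).
  have [k Pk uvy] : (\bigcup_(k in [set k | P k]) box (u k) (v k)) y.
    apply: abuv => j; rewrite mxE; case: unliftP => [i ->|->].
      by have := abx i; rewrite !mxE.
    by move: It; rewrite /I /= in_itv.
  exists k.
    rewrite /Q /= Pk /= inE /J /= in_itv /=.
    by have := uvy 0; rewrite mxE unlift_none.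
  by move=> j; have := uvy (lift ord0 j); rewrite mxE liftK !mxE.
have muitv (c d : R) : c <= d -> mu `[c, d]%classic = (d - c)%:E.
  rewrite /mu lebesgue_measure_itv /= lte_fin le_eqVlt => /predU1P[->|->//].
  by rewrite ltxx subrr.
rewrite vol_recl EFinM -muitv// muleC -integral_cst//=.
apply: (@le_trans _ _ (\int[mu]_(t in I) \sum_(k <oo) h k t)%E).
  apply: ge0_le_integral => //=.
  - by move=> t _; rewrite lee_fin vol_ge0// => j; rewrite !mxE.
  - by apply: (@ge0_emeasurable_sum _ _ _ _ h xpredT).
rewrite integral_nneseries// [leRHS]eseries_mkcond.
apply: lee_nneseries => [k _ _|k _]; first exact: integral_ge0.
rewrite ge0_integralZl_EFin//; last first.
  by apply/measurable_EFinP/measurable_indic; exact: mJ.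
have -> : (\int[mu]_(x in I) (\1_(J k) x)%:E = mu (J k `&` I))%E.
  exact: (integral_indic _ mI (mJ k)).
case: ifP => Pk; last by rewrite mul0e.
rewrite vol_recl EFinM muleC lee_wpmul2r ?lee_fin//.
by rewrite -muitv// le_measure ?inE//; exact: measurableI.
Qed.

Lemma vol_le_outer_measure n (a b : 'rV[R]_n) : (forall j, a 0 j <= b 0 j) ->
  ((vol a b)%:E <= outer_measure (box a b))%E.
Proof.
move=> ab; apply: le_ereal_inf_tmp => s [u [v [uv abuv ->]]].
by apply: vol_le_cover => //; rewrite set_true.
Qed.

(** Complements of null sets are dense: this is what makes the limits of a field
    from inside a region Filippov values. *)
Lemma ball2_notin_null n (x : 'rV[R]_n) (d : R) (A : set 'rV[R]_n) : 0 < d ->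
  null_set A -> exists2 y, ball2 x d y & ~ A y.
Proof.
move=> d0 A0; apply: contrapT => H.
have n1 : (0 : R) < n%:R + 1 by rewrite ltr_wpDl.
pose k : R := d / (n%:R + 1).
have k0 : 0 < k by rewrite divr_gt0.
pose b := x + const_mx k.
have xb j : x 0 j < b 0 j by rewrite !mxE ltrDl.
have bA : box x b `<=` A.
  move=> y xyb; apply: contrapT => Ay; apply: H; exists y => //.
  apply: (@le_lt_trans _ _ (n%:R * k)); last first.
    by rewrite mulrCA gtr_pMr// ltr_pdivrMr// mul1r ltrDl.
  apply: norm2_le_bound (ltW k0) _ => j; have /andP[] := xyb j.
  by rewrite !mxE => xy yb; rewrite ger0_norm ?subr_ge0// lerBlDl.
have := vol_le_outer_measure (fun j => ltW (xb j)).
rewrite (sub_null_set bA A0) lee_fin leNgt => /negP; apply.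
by apply: prodr_gt0 => j _; rewrite subr_gt0.
Qed.

End BoxVolume.

Section NullPreimage.
Variable R : realType.

Definition cube n (K : R) : set 'rV[R]_n := box (const_mx (- K)) (const_mx K).

(** Reduction to boxes: within each cube K the measure of the preimage of a box has
    to be at most a constant times the volume of the box, where the constant may
    depend on K. *)
Lemma null_preimage m n (L : 'rV[R]_m -> 'rV[R]_n) (A : set 'rV[R]_n) :
  (0 < m)%N ->
  (forall K, 0 < K -> exists2 C : R, 0 <= C & forall a b : 'rV[R]_n,
     (forall j, a 0 j <= b 0 j) ->
     (outer_measure (L @^-1` box a b `&` cube K) <= (C * vol a b)%:E)%E) ->
  null_set A -> null_set (L @^-1` A).
Proof.
move=> m0 HL A0.
apply: sub_null_set (@null_bigcup_nat R m
  (fun k => L @^-1` A `&` cube k.+1%:R) m0 _).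
  move=> x Ax; exists (Num.bound `|x|) => //; split=> // j; rewrite !mxE.
  rewrite -ler_norml (le_trans (ler_entry_norm _ _))//.
  rewrite (le_trans (ltW (archi_boundP (normr_ge0 x))))// ler_nat.
  exact: leqnSn.
move=> k; have [C C0 HC] := HL k.+1%:R (ltr0Sn _ _).
apply/eqP; rewrite eq_le outer_measure_nneg andbT.
apply/lee_addgt0Pr => e e0; rewrite add0e.
have C1 : 0 < C + 1 by rewrite ltr_wpDl.
have : (outer_measure A < (e / (C + 1))%:E)%E by rewrite A0 lte_fin divr_gt0.
move=> /ereal_inf_lt[s [a [b [ab Aab ->]]] /ltW He].
apply: (@le_trans _ _ (\sum_(0 <= i <oo)
    outer_measure (L @^-1` box (a i) (b i) `&` cube k.+1%:R))%E).
  apply: le_trans (outer_measure_bigcup _ m0); apply: outer_measureS.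
  by move=> x [/Aab[i _ abx] xk]; exists i.
apply: (@le_trans _ _ (\sum_(0 <= i <oo) (C%:E * (vol (a i) (b i))%:E))%E).
  by apply: lee_nneseries => [i _ _|i _]; [exact: outer_measure_nneg|rewrite -EFinM HC].
rewrite nneseriesZl; last by move=> i _; rewrite lee_fin vol_ge0.
apply: (@le_trans _ _ (C%:E * (e / (C + 1))%:E)%E); first exact: lee_wpmul2l.
rewrite -EFinM lee_fin mulrCA ger_pMr// ler_pdivrMr// mul1r lerDl//.
Qed.

Lemma vol_mxvec p q (a b : 'M[R]_(p, q)) :
  vol (mxvec a) (mxvec b) = \prod_i \prod_l (b i l - a i l).
Proof.
rewrite /vol (reindex _ (curry_mxvec_bij p q)) /=.
rewrite pair_bigA /=; apply: eq_bigr => -[i l] _ /=.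
by rewrite !mxvecE.
Qed.

Lemma nodeE p q (x : 'rV[R]_(p * q)) i l : node x i 0 l = x 0 (mxvec_index i l).
Proof. by rewrite !mxE. Qed.

Lemma cube_node p q (K : R) (x : 'rV[R]_(p * q)) i l :
  cube K x -> - K <= node x i 0 l <= K.
Proof. by move=> /(_ (mxvec_index i l)); rewrite !mxE. Qed.

Lemma box_mxvec p q (a b : 'M[R]_(p, q)) (x : 'rV[R]_(p * q)) :
  (forall i l, a i l <= node x i 0 l <= b i l) -> box (mxvec a) (mxvec b) x.
Proof.
move=> H j; case/mxvec_indexP: j => i l; rewrite !mxvecE.
by have := H i l; rewrite nodeE.
Qed.

Lemma mxvec_le p q (a b : 'M[R]_(p, q)) : (forall i l, a i l <= b i l) ->
  forall j, mxvec a 0 j <= mxvec b 0 j.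
Proof. by move=> ab j; case/mxvec_indexP: j => i l; rewrite !mxvecE. Qed.

Lemma null_node N n (i : 'I_N) (A : set 'rV[R]_n) : (0 < N * n)%N ->
  null_set A -> null_set [set x : 'rV[R]_(N * n) | A (node x i)].
Proof.
move=> Nn; apply: null_preimage => // K K0.
exists (\prod_(i' | i' != i) \prod_(l < n) (K - - K)).
  by apply: prodr_ge0 => j _; apply: prodr_ge0 => l _; rewrite opprK addr_ge0 ?ltW.
move=> a b ab.
pose lo : 'M[R]_(N, n) := \matrix_(i', l) if i' == i then a 0 l else - K.
pose hi : 'M[R]_(N, n) := \matrix_(i', l) if i' == i then b 0 l else K.
have -> : \prod_(i' | i' != i) \prod_(l < n) (K - - K) * vol a b =
    \sum_(u : unit) vol (mxvec lo) (mxvec hi).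
  rewrite (big_pred1 tt); last by case.
  rewrite mulrC vol_mxvec [RHS](bigD1 i)//=; congr (_ * _).
    by apply: eq_bigr => l _; rewrite !mxE eqxx.
  apply: eq_bigr => i' /negPf i'i; apply: eq_bigr => l _.
  by rewrite !mxE i'i.
apply: outer_measure_le_finsum => // [_|x [xab xK]].
  apply: mxvec_le => i' l; rewrite !mxE; case: eqP => // _.
  by rewrite ge0_cp// ltW.
exists tt => //; apply: box_mxvec => i' l; rewrite [lo _ _]mxE [hi _ _]mxE.
by case: eqP => [->|_]; [exact: xab|exact: cube_node].
Qed.

Lemma subdivide (d u : R) m : 0 <= u -> u <= m.+1%:R * d ->
  exists k : 'I_m.+1, k%:R * d <= u <= k%:R * d + d.
Proof.
move=> u0; elim: m => [|m IH] um.
  by exists ord0; rewrite mul0r u0 add0r; rewrite mul1r in um.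
have [um'|um'] := leP u (m.+1%:R * d).
  have [k Hk] := IH um'; exists (widen_ord (leqnSn _) k) => //.
exists ord_max; rewrite (ltW um')/= (le_trans um)// -[X in X * d]natr1 mulrDl.
by rewrite mul1r.
Qed.

(** A box in the difference of two nodes is not a box of the product space. Cut
    the range of node j into small cubes of side d: node i then lies in the box
    shifted by the corner of the cube and widened by d, and the total volume of
    these pieces tends to that of the straight prism. *)
Lemma outer_measure_node_diff N n (i j : 'I_N) (K : R) (a b : 'rV[R]_n) m :
  i != j -> (0 < N * n)%N -> 0 < K -> (forall l, a 0 l <= b 0 l) ->
  (outer_measure
     ([set x : 'rV[R]_(N * n) | box a b (node x i - node x j)%R] `&` cube K) <=
   ((\prod_(i' | (i' != i) && (i' != j)) \prod_(l < n) (K - - K)) *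
    (K + K) ^+ n * \prod_l (b 0 l - a 0 l + (K + K) / m.+1%:R))%:E)%E.
Proof.
move=> ij Nn K0 ab; set d := (K + K) / m.+1%:R.
have d0 : 0 <= d by rewrite divr_ge0// addr_ge0// ltW.
pose c (f : {ffun 'I_n -> 'I_m.+1}) l : R := - K + (f l)%:R * d.
pose lo f : 'M[R]_(N, n) := \matrix_(i', l)
  if i' == i then a 0 l + c f l else if i' == j then c f l else - K.
pose hi f : 'M[R]_(N, n) := \matrix_(i', l)
  if i' == i then b 0 l + c f l + d else if i' == j then c f l + d else K.
have -> : (\prod_(i' | (i' != i) && (i' != j)) \prod_(l < n) (K - - K)) *
    (K + K) ^+ n * \prod_l (b 0 l - a 0 l + d) =
    \sum_f vol (mxvec (lo f)) (mxvec (hi f)).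
  transitivity (\sum_(f : {ffun 'I_n -> 'I_m.+1})
    ((\prod_(i' | (i' != i) && (i' != j)) \prod_(l < n) (K - - K)) *
    d ^+ n * \prod_l (b 0 l - a 0 l + d))).
    rewrite sumr_const card_ffun !card_ord -[RHS]mulr_natl natrX !mulrA.
    rewrite [m.+1%:R ^+ n * _]mulrC -[_ * _ * d ^+ n]mulrA -exprMn.
    by rewrite [m.+1%:R * d]mulrC divfK ?pnatr_eq0.
  apply: eq_bigr => f _; rewrite vol_mxvec [RHS](bigD1 i)//=.
  rewrite [X in _ = _ * X](bigD1 j) 1?eq_sym//= mulrC; congr (_ * _).
    by apply: eq_bigr => l _; rewrite !mxE eqxx; lra.
  rewrite mulrC; congr (_ * _).
    rewrite -[d ^+ n](_ : \prod_(l < n) d = _).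
      apply: eq_bigr => l _; rewrite !mxE eqxx eq_sym (negPf ij).
      by rewrite addrAC subrr add0r.
    by rewrite prodr_const card_ord.
  apply: eq_bigr => i' /andP[/negPf i'i /negPf i'j]; apply: eq_bigr => l _.
  by rewrite !mxE i'i i'j.
apply: outer_measure_le_finsum => // [f|x [xab xK]].
  apply: mxvec_le => i' l; rewrite !mxE; case: eqP => // _.
    by have := ab l; lra.
  by case: eqP => // _; lra.
have /fin_all_exists[f Hf] l : exists k : 'I_m.+1,
    k%:R * d <= node x j 0 l + K <= k%:R * d + d.
  have /andP[xl xu] := cube_node j l xK; apply: subdivide; first lra.
  by rewrite mulrC divfK ?pnatr_eq0//; lra.
exists (finfun f) => //; apply: box_mxvec => i' l.
rewrite [lo _ _ _]mxE [hi _ _ _]mxE /c ffunE.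
have /andP[f1 f2] := Hf l; case: eqP => [->|_].
  have /andP := xab l; rewrite mxE [X in _ + X]mxE => -[xl xu].
  by apply/andP; split; lra.
case: eqP => [->|_]; last exact: cube_node.
by apply/andP; split; lra.
Qed.

Lemma null_node_diff N n (i j : 'I_N) (A : set 'rV[R]_n) : i != j ->
  (0 < N * n)%N ->
  null_set A -> null_set [set x : 'rV[R]_(N * n) | A (node x i - node x j)].
Proof.
move=> ij Nn; apply: null_preimage => // K K0.
set C := (\prod_(i' < N | (i' != i) && (i' != j)) \prod_(l < n) (K - - K)) *
    (K + K) ^+ n.
have C0 : 0 <= C.
  apply: mulr_ge0; last by rewrite exprn_ge0// addr_ge0// ltW.
  by apply: prodr_ge0 => k _; apply: prodr_ge0 => l _; rewrite opprK addr_ge0 ?ltW.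
exists C => // a b ab.
have Hm m := outer_measure_node_diff m ij Nn K0 ab.
set o := outer_measure _ in Hm *.
have fo : o \is a fin_num.
  rewrite ge0_fin_numE; last exact: outer_measure_nneg.
  exact: le_lt_trans (Hm 0%N) (ltry _).
rewrite -(fineK fo) lee_fin.
have : (fun m => C * \prod_l (b 0 l - a 0 l + (K + K) / m.+1%:R)) @ \oo -->
    C * vol a b.
  apply: cvgMr; apply: cvg_big => [|l _]; first exact: mul_continuous.
  rewrite -[X in _ --> X]addr0 -(mulr0 (K + K)).
  apply: cvgD; first exact: cvg_cst.
  by apply: cvgMr; exact: cvg_harmonic.
move/cvgr_to_ge; apply; apply: nearW => m.
by rewrite -lee_fin fineK.
Qed.

End NullPreimage.

(** * Filippov maps of piecewise continuous fields *)

Section FilippovCalculus.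
Local Open Scope convex_scope.
Variable R : realType.

(** The part of piecewise smoothness that the argument uses, in a form that
    continuous fields also have (with a single region). *)
Definition piecewise_continuous n (f : R -> 'rV[R]_n -> 'rV[R]_n) : Prop :=
  exists (p : nat) (S : 'I_p -> set 'rV[R]_n)
         (F : 'I_p -> R -> 'rV[R]_n -> 'rV[R]_n),
    [/\ forall k, open (S k), \bigcup_k closure (S k) = setT,
        null_set (~` \bigcup_k S k),
        forall k t z, 0 <= t -> closure (S k) z -> forall e, 0 < e ->
          exists2 d, 0 < d & forall y, closure (S k) y -> ball2 z d y ->
            norm2 (F k t y - F k t z) < e &
        forall k t x, 0 <= t -> S k x -> f t x = F k t x].

Lemma within_continuous_slice n (A : set 'rV[R]_n) (G : R -> 'rV[R]_n -> 'rV[R]_n) :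
  {within [set q : R^o * 'rV[R]_n | 0 <= q.1 /\ A q.2],
     continuous (fun q : R^o * 'rV[R]_n => G q.1 q.2)} ->
  forall t z, 0 <= t -> A z -> forall e, 0 < e ->
    exists2 d, 0 < d & forall y, A y -> ball2 z d y -> norm2 (G t y - G t z) < e.
Proof.
move=> /subspace_continuousP cG t z t0 Az e e0.
have n1 : (0 : R) < n%:R + 1 by rewrite ltr_wpDl.
have /cvgrPdist_lt /(_ (e / (n%:R + 1))) := cG (t, z) (conj t0 Az).
rewrite divr_gt0// => /(_ isT)[[B C] /= [tB zC] BC].
have [d d0 dC] := ball2_nbhs zC.
exists d => // y Ay zy; rewrite norm2B.
have := BC (t, y); rewrite /= => /(_ _ (conj t0 Ay)) H.
have {}H := H (conj (nbhs_singleton tB) (dC _ zy)).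
apply: le_lt_trans (norm2_le_norm _) _.
apply: (@le_lt_trans _ _ ((n%:R + 1) * `|G t z - G t y|)).
  by rewrite ler_wpM2r// lerDl.
by move: H; rewrite ltr_pdivlMr// mulrC.
Qed.

Lemma regular_piecewise_continuous n (f : R -> 'rV[R]_n -> 'rV[R]_n) :
  (0 < n)%N -> continuous_or_pws f -> piecewise_continuous f.
Proof.
move=> n0 [cf|[p [S [F [[oS _ _] cS nS _ HF]]]]]; last first.
  exists p, S, F; split => //.
    move=> k t z t0 Skz e e0; have [_ + _] := HF k.
    by move=> /within_continuous_slice /(_ t z t0 Skz e e0).
  by move=> k t x t0 Skx; have [_ _] := HF k; apply.
exists 1%N, (fun=> setT), (fun=> f); split => //.
- by move=> _; exact: openT.
- by apply/seteqP; split => // x _; exists ord0 => //; exact: subset_closure.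
- apply: sub_null_set (null_set0 R n0); move=> x; apply.
  by exists ord0.
- move=> _ t z t0 _ e e0.
  have [||d d0 Hd] := @within_continuous_slice _ setT f _ t z t0 _ e e0 => //.
    move: cf; rewrite /continuous_vf.
    by rewrite (_ : [set p | _] = [set q | 0 <= q.1 /\ [set: 'rV_n] q.2])//;
      apply/seteqP; split => [q|q []] //=.
  by exists d => // y _; exact: Hd.
Qed.

(** Balls are not null, so whatever null set is discarded there remain points of the
    region at which the field is close to its limit. *)
Lemma filippov_piece n (f : R -> 'rV[R]_n -> 'rV[R]_n) (S : set 'rV[R]_n)
    (F : R -> 'rV[R]_n -> 'rV[R]_n) t z :
  open S -> closure S z ->
  (forall e, 0 < e -> exists2 d, 0 < d & forall y, closure S y -> ball2 z d y ->
            norm2 (F t y - F t z) < e) ->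
  (forall x, S x -> f t x = F t x) -> filippov f t z (F t z).
Proof.
move=> oS Sz cF fF d /= d0 A A0 N /ball2_nbhs[e e0 eN].
have [d' d'0 Hd'] := cF e e0.
have m0 : 0 < Num.min d d' by rewrite lt_min d0.
have [y [Sy yz]] := Sz _ (nbhs_ball2 z m0).
move: yz; rewrite /ball2 /= lt_min => /andP[yd yd'].
have /ball2_nbhs[r r0 rS] : nbhs y S by apply: open_nbhs_nbhs.
have k0 : 0 < Num.min r (Num.min (d - norm2 (y - z)) (d' - norm2 (y - z))).
  by rewrite !lt_min r0 !subr_gt0 yd.
have [w + Aw] := ball2_notin_null y k0 A0.
rewrite /ball2 /= !lt_min !ltrBrDr => /and3P[wr wd wd'].
have Sw : S w by exact: rS.
have wz : norm2 (w - z) <= norm2 (w - y) + norm2 (y - z).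
  by rewrite -(subrKA y w) ler_norm2D.
exists (f t w); split.
  apply: sub_gen_smallest; exists w => //; split => //.
  exact: le_lt_trans wd.
apply: eN; rewrite /ball2/= fF//; apply: Hd'; first exact: subset_closure.
exact: le_lt_trans wd'.
Qed.

(** Off one null set the values of the field are Filippov values and stay
    bounded near every point; so estimates known for Filippov values are
    available for the values of the field that the Filippov map of a network of
    such fields is built from. *)
Lemma piecewise_continuous_filippov n (f : R -> 'rV[R]_n -> 'rV[R]_n) :
  piecewise_continuous f ->
  exists D : set 'rV[R]_n,
    [/\ null_set D,
        forall t z, 0 <= t -> ~ D z -> filippov f t z (f t z),
        forall t z, 0 <= t -> filippov f t z !=set0 &
        forall t z, 0 <= t -> exists d B, 0 < d /\
          forall y, ball2 z d y -> ~ D y -> norm2 (f t y) <= B].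
Proof.
move=> [p [S [F [oS cS nS cF fF]]]].
exists (~` \bigcup_k S k); split => //.
- move=> t z t0 /contrapT[k _ Skz]; rewrite (fF k t z)//.
  have cSkz := subset_closure Skz.
  exact: filippov_piece (oS k) cSkz (cF k t z t0 cSkz) (fun x => fF k t x t0).
- move=> t z t0; have [k _ Skz] : (\bigcup_k closure (S k)) z by rewrite cS.
  exists (F k t z).
  exact: filippov_piece (oS k) Skz (cF k t z t0 Skz) (fun x => fF k t x t0).
- move=> t z t0.
  have /fin_all_exists[B HB] k : exists B : R,
      \forall y \near z, S k y -> norm2 (f t y) <= B.
    have [Skz|Skz] := pselect (closure (S k) z); last first.
      exists 0; have : nbhs z (~` closure (S k)).
        by apply: open_nbhs_nbhs; split => //; exact/closed_openC/closed_closure.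
      by apply: filterS => y Sky /subset_closure.
    have [d d0 Hd] := cF k t z t0 Skz 1 ltr01.
    exists (norm2 (F k t z) + 1).
    apply: filterS (nbhs_ball2 z d0) => y yz Sky; rewrite (fF k)//.
    rewrite -lerBlDl (le_trans (ler_norm2B _ _))// ltW// Hd//.
    exact: subset_closure.
  have /ball2_nbhs[d d0 Hd] : \forall y \near z, forall k,
      S k y -> norm2 (f t y) <= B k.
    exact: (@filter_forall _ _ (fun k y => S k y -> norm2 (f t y) <= B k) (nbhs z) _ HB).
  exists d, (\sum_k `|B k|); split => // y yz /contrapT[k _ Sky].
  rewrite (le_trans (Hd _ yz k Sky))// (le_trans (ler_norm _))//.
  by rewrite (bigD1 k)//= lerDl sumr_ge0.
Qed.

(** A half-space that contains the values of the field off a null set, near x,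
    contains their closed convex hull. *)
Lemma filippov_halfspace n (f : R -> 'rV[R]_n -> 'rV[R]_n) t x v
    (p : 'rV[R]_n) (D : set 'rV[R]_n) (d b : R) :
  null_set D -> 0 < d ->
  (forall y, ball2 x d y -> ~ D y -> dot p (f t y) <= b) ->
  filippov f t x v -> dot p v <= b.
Proof.
move=> D0 d0 Hb /(_ d d0 D D0) vcl.
have hull : convex_hull (f t @` (ball2 x d `\` D)) `<=` [set w | dot p w <= b].
  apply: smallest_sub => [u w l|_ [y [yx Dy] <-]]; last exact: Hb.
  rewrite !inE /= => ub wb.
  rewrite (_ : u <| l |> w =
    l%:num *: (u : 'rV[R]_n) + (1 - l%:num) *: (w : 'rV[R]_n))//.
  have l0 : 0 <= l%:num by [].
  have l1 : l%:num <= 1 by [].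
  by rewrite dotDr !dotZr; nra.
apply/ler_addgt0Pr => e e0.
have p1 : 0 < norm2 p + 1 by rewrite ltr_wpDl// norm2_ge0.
have [w [/hull /= wb wv]] := vcl _ (nbhs_ball2 v (divr_gt0 e0 p1)).
rewrite -(subrK w v) dotDr addrC lerD//.
apply: le_trans (dot_le_norm2 _ _) _; rewrite norm2B.
apply: (@le_trans _ _ ((norm2 p + 1) * norm2 (w - v))).
  by rewrite ler_wpM2r ?norm2_ge0// lerDl.
by move: wv; rewrite /ball2 /= ltr_pdivlMr// mulrC => /ltW.
Qed.

(** Local boundedness turns estimates with the moving factor [l y] into the same
    estimate at x with the fixed factor [l x]. *)
Lemma filippov_dot_le n (f : R -> 'rV[R]_n -> 'rV[R]_n) t x v
    (l : 'rV[R]_n -> 'rV[R]_n) (D : set 'rV[R]_n) (d B : R) (Phi : R -> R) :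
  (forall y z, norm2 (l y - l z) <= norm2 (y - z)) ->
  {for norm2 (l x), continuous Phi} ->
  null_set D -> 0 < d ->
  (forall y, ball2 x d y -> ~ D y -> norm2 (f t y) <= B) ->
  (forall y, ball2 x d y -> ~ D y -> dot (l y) (f t y) <= Phi (norm2 (l y))) ->
  filippov f t x v -> dot (l x) v <= Phi (norm2 (l x)).
Proof.
move=> l1 cPhi D0 d0 HB HPhi fv.
apply/ler_addgt0Pr => e e0.
have e2 : 0 < e / 2 by rewrite divr_gt0.
have B1 : 0 < `|B| + 1 by rewrite ltr_wpDl.
have /cvgrPdist_lt /(_ _ e2) /nbhs_ballP[r /= r0 Hr] := cPhi.
pose d' := Num.min d (Num.min r (e / 2 / (`|B| + 1))).
have d'0 : 0 < d' by rewrite !lt_min d0 r0 divr_gt0.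
apply: filippov_halfspace D0 d'0 _ fv => y.
rewrite /ball2 /= !lt_min => /and3P[yd yr ye] Dy.
rewrite -[X in dot X _](subrK (l y)) dotDl addrC [e]splitr addrA lerD//.
  apply: le_trans (HPhi _ yd Dy) _.
  have /Hr : ball (norm2 (l x)) r (norm2 (l y)).
    rewrite -ball_normE /=; apply: le_lt_trans (ler_dist_norm2 _ _) _.
    by apply: le_lt_trans (l1 _ _) _; rewrite norm2B.
  by rewrite /= ltr_norml => /andP[H _]; lra.
apply: le_trans (dot_le_norm2 _ _) _.
apply: (@le_trans _ _ (norm2 (y - x) * (`|B| + 1))); last first.
  by move: ye; rewrite ltr_pdivlMr// => /ltW.
rewrite ler_pM ?norm2_ge0//; first by rewrite (norm2B y).
by rewrite (le_trans (HB _ yd Dy))// (le_trans (ler_norm _))// lerDl.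
Qed.

End FilippovCalculus.

(** * Absolutely continuous functions with a bounded growth rate *)

Section AbsoluteContinuity.
Variable R : realType.
Local Notation mu := (@lebesgue_measure R).

(** A bound q on the rate of growth at t, measured on the intervals around t: in
    this form it adds up over adjacent intervals. *)
Definition straddle_le (F : R -> R) (q t : R) : Prop :=
  forall e, 0 < e -> exists2 d, 0 < d & forall u v, u <= t <= v ->
    t - u < d -> v - t < d -> F v - F u <= (q + e) * (v - u).

(** Absolute continuity on [a, b], with the upper bound only: the growth is all that
    has to be controlled. *)
Definition ac_above (a b : R) (F : R -> R) : Prop :=
  forall e : R, 0 < e -> exists2 d : R, 0 < d &
    forall (m : nat) (u v : 'I_m -> R),
      (forall k, a <= u k /\ u k <= v k /\ v k <= b) ->
      trivIset setT (fun k => `]u k, v k[%classic) ->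
      \sum_k (v k - u k) < d ->
      \sum_k (F (v k) - F (u k)) < e.

Lemma sum_length_lt m (u v : 'I_m -> R) (U : set R) (d : R) : open U ->
  (forall k, u k <= v k) -> trivIset setT (fun k => `]u k, v k[%classic) ->
  (forall k t, u k <= t <= v k -> U t) -> (mu U < d%:E)%E ->
  \sum_k (v k - u k) < d.
Proof.
move=> oU uv tuv uvU Ud; rewrite -lte_fin; apply: le_lt_trans Ud.
pose I k : set (measurableTypeR R) := `]u k, v k[%classic.
have mI k : measurable (I k) by exact: measurable_itv.
have mbI : measurable (\big[setU/set0]_k I k) by exact: bigsetU_measurable.
have muI k : mu (I k) = (v k - u k)%:E.
  rewrite /I lebesgue_measure_itv /= lte_fin.
  by case: ltgtP (uv k) => // -> _; rewrite subrr.
have -> : (\sum_k (v k - u k))%:E = mu (\big[setU/set0]_k I k).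
  rewrite (measure_semi_additive_ord _ mI tuv mbI) -sumEFin.
  by apply: eq_bigr => k _; exact/esym/muI.
rewrite le_measure ?inE//; first exact: open_measurable.
apply: (big_ind (fun A => A `<=` U)) => // [A B AU BU x [/AU|/BU]//|k _ t].
by rewrite /I /= in_itv /= => /andP[ut tv]; apply: (uvU k); rewrite !ltW.
Qed.

Lemma trivIset_pairwise (s : seq (R * R)) :
  pairwise (fun p q => q.2 <= p.1) s ->
  trivIset setT (fun k : 'I_(size s) =>
    `](nth (0, 0) s k).1, (nth (0, 0) s k).2[%classic).
Proof.
move=> /(pairwiseP (0, 0)) H.
suff K (i j : 'I_(size s)) : (i < j)%N -> forall t,
    t \in `](nth (0, 0) s i).1, (nth (0, 0) s i).2[ ->
    t \in `](nth (0, 0) s j).1, (nth (0, 0) s j).2[ -> False.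
  move=> i j _ _ [t [/= ti tj]]; apply/val_inj => /=.
  by case: (ltngtP i j) => // [/K|/K] /(_ t); [move=> /(_ ti tj)|move=> /(_ tj ti)].
move=> ij t; rewrite !in_itv /= => /andP[it _] /andP[_ tj].
have /= := H i j (ltn_ord i) (ltn_ord j) ij.
by rewrite leNgt (lt_trans it tj).
Qed.

(** An absolutely continuous function whose growth rate is at most 0 off a null
    set does not grow. Enclose the null set in an open U of small measure and
    sweep from a to b: at a good point the function grows at most at rate e, at a
    bad point a whole interval around it lies in U and is put on a list. The
    listed intervals are disjoint and short in total, so absolute continuity
    bounds the growth over them. The sweep reaches b because the supremum of the
    points reached could be passed otherwise. *)
Lemma ac_nonincreasing (a b : R) (F : R -> R) : a <= b -> ac_above a b F ->
  {ae mu, forall t, a < t < b -> straddle_le F 0 t} -> F b <= F a.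
Proof.
move=> ab acF [A0 [mA0 A00 HA0]].
pose A : set (measurableTypeR R) := A0 `|` ([set a] `|` [set b]).
have mA : measurable A by apply: measurableU => //; exact: measurableU.
have A_0 : mu A = 0%E.
  apply/(negligibleP _ mA)/negligibleU; first exact/negligibleP.
  by apply: negligibleU; apply/negligibleP => //; exact: lebesgue_measure_set1.
have HA t : a <= t <= b -> ~ A t -> straddle_le F 0 t.
  move=> /andP[]; rewrite le_eqVlt => /predU1P[<- _ At|at_].
    by exfalso; apply: At; right; left.
  rewrite le_eqVlt => /predU1P[->  At|tb At].
    by exfalso; apply: At; right; right.
  apply: contrapT => Ht; apply: At; left; apply: HA0 => H; apply: Ht.
  by apply: H; rewrite at_.
apply/ler_addgt0Pr => e0 e00.
have ba1 : 0 < b - a + 1 by rewrite ltr_wpDl// subr_ge0.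
pose e := e0 / (b - a + 1).
have e_gt0 : 0 < e by rewrite divr_gt0.
have [d d0 Hd] := acF e e_gt0.
have Aoo : (mu A < +oo)%E by rewrite A_0.
have [U [oU AU UA]] := lebesgue_regularity_outer mA Aoo d0.
have Ud : (mu U < d%:E)%E.
  apply: le_lt_trans UA.
  have mU : measurable (U : set (measurableTypeR R)) by exact: open_measurable.
  have -> : mu U = (mu (U `\` A) + mu (U `&` A))%E by exact: measureDI.
  rewrite [X in (_ + X)%E](_ : _ = 0%E) ?adde0//.
  by apply/eqP; rewrite -measure_le0 -A_0 le_measure ?inE//; exact: measurableI.
(* C t: the sweep has reached t; the list s holds the intervals inside U. *)
pose C t := [/\ a <= t, t <= b & exists s : seq (R * R),
  [/\ pairwise (fun p q => q.2 <= p.1) s,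
      forall p, p \in s -> [/\ a <= p.1, p.1 <= p.2, p.2 <= t &
                               forall x, p.1 <= x <= p.2 -> U x] &
      F t - F a <= e * (t - a) + \sum_(p <- s) (F p.2 - F p.1)]].
have Ca : C a.
  by split => //; exists [::]; split => //; rewrite big_nil !subrr mulr0 addr0.
have supC : has_sup [set t | C t] by split; [exists a|exists b => t []].
pose c := sup [set t | C t].
have ac : a <= c by exact: (ub_le_sup supC.2 Ca).
have cb : c <= b by apply: ge_sup; [exists a|move=> t []].
have [r r0 Hr] : exists2 r, 0 < r & forall u v, a <= u -> u <= c <= v -> v <= b ->
    c - u < r -> v - c < r -> C u -> C v.
  have [Ac|/(HA c)] := pselect (A c).
    have /nbhs_ballP[r /= r0 rU] : nbhs c U by exact: open_nbhs_nbhs (conj oU (AU _ Ac)).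
    exists r => // u v au /andP[uc cv] vb cur vcr [_ _ [s [ps sU Fu]]].
    have uv := le_trans uc cv.
    split; [exact: le_trans uv|by []|exists ((u, v) :: s); split].
    - by rewrite /= ps andbT; apply/allP => p /sU[].
    - move=> p; rewrite inE => /predU1P[->/=|/sU[? ? pu ?]].
        split => // x /andP[ux xv]; apply: rU; rewrite -ball_normE /= ltr_norml.
        by apply/andP; split; lra.
      by split => //; exact: le_trans uv.
    - rewrite big_cons /=.
      have : 0 <= e * (v - u) by rewrite mulr_ge0 ?subr_ge0// ltW.
      by move: Fu; lra.
  rewrite ac cb => /(_ isT e e_gt0)[r r0 Hr].
  exists r => // u v au ucv vb cur vcr [_ _ [s [ps sU Fu]]].
  have /andP[uc cv] := ucv; have uv := le_trans uc cv.
  split; [exact: le_trans uv|by []|exists s; split => //].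
    by move=> p /sU[? ? pu ?]; split => //; exact: le_trans uv.
  by have := Hr u v ucv cur vcr; move: Fu; lra.
have [u Cu cu] := sup_adherent r0 supC.
have uc : u <= c by exact: (ub_le_sup supC.2 Cu).
have [au _ _] := Cu.
have Cb : C b.
  have Cv : C (Num.min b (c + r / 2)).
    apply: (Hr u) => //; first by rewrite uc le_min cb lerDl divr_ge0// ltW.
    - by rewrite ge_min lexx.
    - by move: cu; rewrite -/c; lra.
    - by rewrite ltrBlDl gt_min ltrD2l; apply/orP; right; lra.
  have := ub_le_sup supC.2 Cv; rewrite -/c ge_min => /orP[bc|]; last by move: r0; lra.
  by move: Cv; rewrite min_l// (le_trans bc)// lerDl divr_ge0// ltW.
have [_ _ [s [ps sU Fb]]] := Cb.
have sumF : \sum_(p <- s) (F p.2 - F p.1) < e.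
  rewrite (big_nth (0, 0)) big_mkord.
  apply: (Hd _ (fun k : 'I__ => (nth (0, 0) s k).1) (fun k => (nth (0, 0) s k).2)).
  - by move=> k; have [] := sU _ (mem_nth (0, 0) (ltn_ord k)).
  - exact: trivIset_pairwise.
  - apply: sum_length_lt oU _ _ _ Ud.
    + by move=> k; have [] := sU _ (mem_nth (0, 0) (ltn_ord k)).
    + exact: trivIset_pairwise.
    + by move=> k; have [_ _ _] := sU _ (mem_nth (0, 0) (ltn_ord k)).
have <- : e * (b - a + 1) = e0 by rewrite divfK// gt_eqF.
by rewrite mulrDr mulr1; move: Fb sumF; lra.
Qed.

Lemma ac_decrease_rate (a b q : R) (F : R -> R) : a <= b -> 0 <= q ->
  ac_above a b F ->
  {ae mu, forall t, a < t < b -> straddle_le F (- q) t} ->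
  F b <= F a - q * (b - a).
Proof.
move=> ab q0 acF sF.
suff : F b + q * b <= F a + q * a by lra.
apply: (@ac_nonincreasing a b (fun t => F t + q * t)) => //.
  move=> e e0; have e2 : 0 < e / 2 by rewrite divr_gt0.
  have q1 : 0 < q + 1 by rewrite ltr_wpDl.
  have [d d0 Hd] := acF _ e2.
  exists (Num.min d (e / 2 / (q + 1))); first by rewrite lt_min d0 divr_gt0.
  move=> m u v uv tuv; rewrite lt_min ltr_pdivlMr// => /andP[sd se].
  rewrite (eq_bigr (fun k => (F (v k) - F (u k)) + q * (v k - u k))); last first.
    by move=> k _; lra.
  rewrite big_split /= -mulr_sumr.
  have := Hd m u v uv tuv sd.
  have : 0 <= \sum_k (v k - u k).
    by apply: sumr_ge0 => k _; rewrite subr_ge0; have [_ []] := uv k.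
  by move: se; set S := \sum_k (v k - u k); nra.
move: sF; apply: negligibleS => t /= nst st; apply: nst => /st {}st e e0.
have [d d0 Hd] := st e e0; exists d => // u v utv tu vt.
by have := Hd u v utv tu vt; lra.
Qed.

End AbsoluteContinuity.

(** * Curves with a bounded radial velocity *)

Section Lyapunov.
Variables (R : realType) (n : nat).
Local Notation mu := (@lebesgue_measure R).
Implicit Types (z : R -> 'rV[R]_n) (w : 'rV[R]_n) (a b t : R).

(** Differentiability at t in the Euclidean norm: this form passes at once to images
    under linear contractions. *)
Definition has_velocity z t w : Prop := forall e, 0 < e ->
  exists2 d, 0 < d & forall s, `|s - t| < d ->
    norm2 (z s - z t - (s - t) *: w) <= e * `|s - t|.

Lemma derivable_has_velocity z t :
  derivable z t 1 -> has_velocity z t (derive1 z t).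
Proof.
move=> dz e e0; have n1 : (0 : R) < n%:R + 1 by rewrite ltr_wpDl.
move: dz; rewrite /derivable derive1E /derive.
set q := (fun h => _) => /cvgrPdist_lt /(_ _ (divr_gt0 e0 n1)).
set w := lim _ => /nbhs_ballP[d /= d0 Hd].
exists d => // s std; have [->|st] := eqVneq s t.
  by rewrite !subrr scale0r subrr norm20 normr0 mulr0.
have st0 : s - t != 0 by rewrite subr_eq0.
have : ball (0 : R) d (s - t) by rewrite -ball_normE /= sub0r normrN.
move=> /Hd /(_ st0); rewrite /q /= [(s - t)%:A](mulr1) subrK => Hw.
rewrite -[z s - z t](scalerKV st0) -scalerBr norm2Z mulrC norm2B.
rewrite ler_wpM2r//.
apply: le_trans (norm2_le_norm _) _.
apply: (@le_trans _ _ ((n%:R + 1) * `|w - (s - t)^-1 *: (z s - z t)|)).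
  by rewrite ler_wpM2r// lerDl.
by move: Hw; rewrite ltr_pdivlMr// mulrC => /ltW.
Qed.

Lemma has_velocity_contraction m (l : 'rV[R]_n -> 'rV[R]_m) z t w :
  (forall k x y, l (k *: x + y) = k *: l x + l y) ->
  (forall x, norm2 (l x) <= norm2 x) ->
  has_velocity z t w -> forall e, 0 < e ->
    exists2 d, 0 < d & forall s, `|s - t| < d ->
    norm2 (l (z s) - l (z t) - (s - t) *: l w) <= e * `|s - t|.
Proof.
move=> lin l1 zw e e0; have [d d0 Hd] := zw e e0.
exists d => // s /Hd; apply: le_trans; apply: le_trans (l1 _).
have -> : l (z s - z t - (s - t) *: w) = l (z s) - l (z t) - (s - t) *: l w.
  have -> : z s - z t - (s - t) *: w =
      (- (s - t)) *: w + (-1 *: z t + z s) by rewrite scaleNr scaleN1r addrC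
        (addrC (- z t)).
  by rewrite !lin scaleNr scaleN1r addrC (addrC (- l (z t))).
by [].
Qed.

(** Expand |z(s)|^2 around z(t): the first-order term is 2 (s - t) <z(t), w>, and the
    constant c makes the remainder at most e |s - t|. *)
Lemma straddle_sqr_norm z t w q : has_velocity z t w -> dot (z t) w <= q ->
  straddle_le (fun s => norm2 (z s) ^+ 2) (2 * q) t.
Proof.
move=> zw zwq e e0.
pose N := norm2 (z t) + 1; pose W := norm2 w + 1.
have N0 : 0 < N by rewrite ltr_wpDl// norm2_ge0.
have W0 : 0 < W by rewrite ltr_wpDl// norm2_ge0.
pose c := Num.min 1 (e / (4 * N)).
have c0 : 0 < c by rewrite lt_min ltr01 divr_gt0// mulr_gt0.
have c1 : c <= 1 by rewrite ge_min lexx.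
have cN : 2 * N * c <= e / 2.
  have : c <= e / (4 * N) by rewrite ge_min lexx orbT.
  by rewrite ler_pdivlMr ?mulr_gt0//; lra.
have [d d0 Hd] := zw c c0.
exists (Num.min d (e / (2 * W ^+ 2))).
  by rewrite lt_min d0 divr_gt0// mulr_gt0// exprn_gt0.
have step s : `|s - t| < Num.min d (e / (2 * W ^+ 2)) ->
    `|norm2 (z s) ^+ 2 - norm2 (z t) ^+ 2 - 2 * (s - t) * dot (z t) w| <= e * `|s - t|.
  rewrite lt_min ltr_pdivlMr ?mulr_gt0 ?exprn_gt0// => /andP[/Hd + sW].
  set r := z s - z t - (s - t) *: w => rc.
  have zs : z s - z t = (s - t) *: w + r by rewrite /r [RHS]addrC subrK.
  have nzs : norm2 (z s - z t) <= W * `|s - t|.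
    rewrite zs (le_trans (ler_norm2D _ _))// norm2Z.
    have := normr_ge0 (s - t); have := rc; rewrite /W.
    by move: (norm2 r) (norm2 w) `|s - t| => x y u; nra.
  have nzs2 : norm2 (z s - z t) ^+ 2 <= e / 2 * `|s - t|.
    apply: (@le_trans _ _ ((W * `|s - t|) ^+ 2)).
      by rewrite ler_pXn2r ?nnegrE ?mulr_ge0 ?norm2_ge0// ltW.
    by have := normr_ge0 (s - t); move: sW; move: `|s - t| => u; nra.
  have -> : norm2 (z s) ^+ 2 - norm2 (z t) ^+ 2 - 2 * (s - t) * dot (z t) w =
      2 * dot (z t) r + norm2 (z s - z t) ^+ 2.
    rewrite !sqr_norm2 /r !dotBr dotZr !dotBl (dotC (z s) (z t)).
    by ring.
  rewrite (le_trans (ler_normD _ _))// [X in _ + X]ger0_norm ?sqr_ge0//.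
  have : `|dot (z t) r| <= norm2 (z t) * norm2 r.
    by rewrite ler_norml lerNl -dotNr -(norm2N r) dot_le_norm2 norm2N dot_le_norm2.
  have := norm2_ge0 (z t); have := norm2_ge0 r.
  have := normr_ge0 (s - t).
  rewrite normrM ger0_norm//; move: nzs2 rc cN; rewrite /N.
  move: (norm2 (_ - _) ^+ 2) (norm2 r) (norm2 (z t)) `|s - t| `|dot _ _|.
  by move=> x y v u g; nra.
move=> u v /andP[ut tv] tu vt.
have /step Hv : `|v - t| < Num.min d (e / (2 * W ^+ 2)).
  by rewrite ger0_norm ?subr_ge0.
have /step Hu : `|u - t| < Num.min d (e / (2 * W ^+ 2)).
  by rewrite distrC ger0_norm ?subr_ge0.
move: Hu Hv; rewrite [`|u - t|]distrC [`|t - u|]ger0_norm ?subr_ge0//.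
rewrite [`|v - t|]ger0_norm ?subr_ge0// !ler_norml => /andP[Hu _] /andP[_ Hv].
have : 0 <= (v - u) * (q - dot (z t) w).
  by rewrite mulr_ge0 ?subr_ge0// (le_trans ut).
by move: Hu Hv; nra.
Qed.

Lemma ac_on_sub a b a' b' z : a <= a' -> b' <= b ->
  absolutely_continuous_on a b z -> absolutely_continuous_on a' b' z.
Proof.
move=> aa bb acz e e0; have [d d0 Hd] := acz e e0.
exists d => // m u v uv; apply: Hd => k; have [au [ukv vb]] := uv k.
by split; [exact: le_trans au|split => //; exact: le_trans bb].
Qed.

Lemma ac_uniformly_continuous a b z : absolutely_continuous_on a b z ->
  forall e, 0 < e -> exists2 d, 0 < d & forall s t,
    a <= s <= b -> a <= t <= b -> `|s - t| < d -> norm2 (z s - z t) < e.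
Proof.
move=> acz e e0; have [d d0 Hd] := acz e e0; exists d => //.
suff H s t : a <= s -> s <= t -> t <= b -> t - s < d -> norm2 (z t - z s) < e.
  move=> s t /andP[as_ sb] /andP[at_ tb]; have [st|st] := leP s t.
    by rewrite distrC norm2B ger0_norm ?subr_ge0//; exact: H.
  by rewrite ger0_norm ?subr_ge0 ?ltW//; apply: H => //; exact: ltW.
move=> as_ st tb std.
have := Hd 1%N (fun=> s) (fun=> t); rewrite !big_ord1; apply=> //.
by apply/trivIsetP => i j _ _; rewrite (ord1 i) (ord1 j) eqxx.
Qed.

Lemma ac_within_continuous a b z : absolutely_continuous_on a b z ->
  {within `[a, b], continuous (fun t => norm2 (z t))}.
Proof.
move=> /ac_uniformly_continuous ucz; apply/subspace_continuousP => t /= tab.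
apply/cvgrPdist_lt => e e0; have [d d0 Hd] := ucz e e0.
apply/nbhs_ballP; exists d => // s; rewrite -ball_normE /= => st sab.
apply: le_lt_trans (ler_dist_norm2 _ _) _.
by move: tab sab; rewrite !in_itv /= => tab sab; exact: Hd.
Qed.

Lemma ac_sqr_norm a b z : a <= b -> absolutely_continuous_on a b z ->
  ac_above a b (fun t => norm2 (z t) ^+ 2).
Proof.
move=> ab acz e e0.
have [c _ Hc] := EVT_max ab (ac_within_continuous acz).
pose K := 2 * norm2 (z c) + 1.
have K0 : 0 < K by rewrite ltr_wpDl// mulr_ge0// norm2_ge0.
have [d d0 Hd] := acz _ (divr_gt0 e0 K0).
exists d => // m u v uv tuv sd; have := Hd m u v uv tuv sd.
rewrite ltr_pdivlMr// mulrC mulr_sumr; apply: le_lt_trans.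
apply: ler_sum => k _; have [au [ukv vb]] := uv k.
have /Hc : u k \in `[a, b] by rewrite in_itv /= au (le_trans ukv).
have /Hc : v k \in `[a, b] by rewrite in_itv /= (le_trans au).
have := ler_norm2B (z (v k)) (z (u k)).
have := norm2_ge0 (z (v k)); have := norm2_ge0 (z (u k)).
have := norm2_ge0 (z (v k) - z (u k)); rewrite /K.
move: (norm2 (z c)) (norm2 (z (v k))) (norm2 (z (u k))) (norm2 (_ - _)).
by move=> C x y g; nra.
Qed.

Lemma sqr_norm_decrease a b z q r : a <= b -> 0 <= q ->
  absolutely_continuous_on a b z ->
  (forall t, a < t < b -> r < norm2 (z t)) ->
  {ae mu, forall t, a < t < b ->
     exists2 w, has_velocity z t w & r < norm2 (z t) -> dot (z t) w <= - q} ->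
  norm2 (z b) ^+ 2 <= norm2 (z a) ^+ 2 - 2 * q * (b - a).
Proof.
move=> ab q0 acz zr vz.
apply: (@ac_decrease_rate R a b (2 * q) (fun t => norm2 (z t) ^+ 2)) => //.
- by rewrite mulr_ge0.
- exact: ac_sqr_norm.
move: vz; apply: negligibleS => t /= nst st; apply: nst => tab.
have [w zw dw] := st tab.
by rewrite -mulrN; apply: straddle_sqr_norm zw (dw (zr t tab)).
Qed.

(** After its last visit to the ball the curve stays outside, where the norm cannot
    grow. *)
Lemma ball_invariant a b z r : a <= b ->
  absolutely_continuous_on a b z ->
  {ae mu, forall t, a < t < b ->
     exists2 w, has_velocity z t w & r < norm2 (z t) -> dot (z t) w <= 0} ->
  norm2 (z a) <= r -> norm2 (z b) <= r.
Proof.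
move=> ab acz vz za; rewrite leNgt; apply/negP => zb.
have r0 : 0 <= r by exact: le_trans (norm2_ge0 _) za.
pose S := [set t | a <= t <= b /\ norm2 (z t) <= r].
have Sa : S a by split => //; rewrite lexx.
have supS : has_sup S by split; [exists a|exists b => t [/andP[]]].
pose c := sup S.
have ac : a <= c by exact: (ub_le_sup supS.2 Sa).
have cb : c <= b by apply: ge_sup; [exists a|move=> t [/andP[]]].
have zc : norm2 (z c) <= r.
  apply/ler_addgt0Pr => e e0.
  have [d d0 Hd] := ac_uniformly_continuous acz e0.
  have [t St ct] := sup_adherent d0 supS.
  have tc : t <= c by exact: (ub_le_sup supS.2 St).
  have [tab zt] := St.
  have : norm2 (z c - z t) < e.
    apply: Hd => //; first by rewrite ac.
    by rewrite ger0_norm ?subr_ge0//; move: ct; rewrite -/c; lra.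
  by have := ler_norm2B (z c) (z t); lra.
have after t : c < t < b -> r < norm2 (z t).
  move=> /andP[ct tb]; rewrite ltNge; apply/negP => zt.
  have : S t by split => //; rewrite ltW//= ?(ltW tb) ?(le_lt_trans ac ct).
  by move=> /(ub_le_sup supS.2); rewrite -/c leNgt ct.
have vzc : {ae mu, forall t, c < t < b ->
    exists2 w, has_velocity z t w & r < norm2 (z t) -> dot (z t) w <= - 0}.
  move: vz; apply: negligibleS => t /= nst st; apply: nst => /andP[ct tb].
  have [|w zw H] := st; first by rewrite (le_lt_trans ac ct).
  by exists w => //; rewrite oppr0.
have := sqr_norm_decrease cb (lexx 0) (ac_on_sub ac (lexx b) acz) after vzc.
rewrite mulr0 mul0r subr0 leNgt => /negP; apply.
rewrite ltr_pXn2r ?nnegrE ?norm2_ge0//; exact: le_lt_trans zb.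
Qed.

(** Where |z| >= k/m, the bound on <z, z'> is nonpositive. *)
Lemma radial_decay_bound a b z m k r : a <= b -> 0 < m -> k / m <= r ->
  absolutely_continuous_on a b z ->
  {ae mu, forall t, a < t < b -> exists2 w, has_velocity z t w &
     dot (z t) w <= - m * norm2 (z t) ^+ 2 + k * norm2 (z t)} ->
  norm2 (z a) <= r -> norm2 (z b) <= r.
Proof.
move=> ab m0 kmr acz vz; apply: (ball_invariant ab acz).
move: vz; apply: negligibleS => t /= nst st; apply: nst => /st[w zw Hw].
exists w => // rz; apply: le_trans Hw _.
rewrite ler_pdivrMr// in kmr.
have := norm2_ge0 (z t); move: rz; move: (norm2 (z t)) => x rx x0.
have : 0 <= x * (m * (x - r)) by rewrite !mulr_ge0 ?subr_ge0// ltW.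
have : 0 <= x * (r * m - k) by rewrite mulr_ge0 ?subr_ge0.
by lra.
Qed.

(** Outside the ball of radius k/m + nu the squared norm falls at a fixed rate, so
    that ball is reached in finite time, and it is invariant. *)
Lemma radial_decay_limit z m k : 0 < m -> 0 <= k ->
  (forall T, 0 <= T -> absolutely_continuous_on 0 T z) ->
  {ae mu, forall t, 0 <= t -> exists2 w, has_velocity z t w &
     dot (z t) w <= - m * norm2 (z t) ^+ 2 + k * norm2 (z t)} ->
  forall nu, 0 < nu -> exists2 t0, 0 < t0 & forall t, t0 < t ->
    norm2 (z t) <= k / m + nu.
Proof.
move=> m0 k0 acz vz nu nu0; pose r := k / m + nu.
have km : 0 <= k / m by rewrite divr_ge0// ltW.
have r0 : 0 < r by rewrite ltr_wpDl.
pose q := r * (m * nu).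
have q0 : 0 < q by rewrite !mulr_gt0.
have [[s s0 zs]|H] := pselect (exists2 s, 0 < s & norm2 (z s) <= r).
  exists s => // t st; apply: (@radial_decay_bound s t z m k r) => //.
  - exact: ltW.
  - by rewrite lerDl ltW.
  - exact: ac_on_sub (ltW s0) (lexx t) (acz t (ltW (lt_trans s0 st))).
  move: vz; apply: negligibleS => x /= nst st'; apply: nst => /andP[sx _].
  by apply: st'; rewrite ltW// (lt_trans s0).
exfalso; pose T := norm2 (z 0) ^+ 2 / (2 * q) + 1.
have T0 : 0 < T by rewrite ltr_wpDl// divr_ge0 ?sqr_ge0// mulr_ge0// ltW.
have away t : 0 < t < T -> r < norm2 (z t).
  by move=> /andP[t0 _]; rewrite ltNge; apply/negP => zt; apply: H; exists t.
have vzq : {ae mu, forall t, 0 < t < T ->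
    exists2 w, has_velocity z t w & r < norm2 (z t) -> dot (z t) w <= - q}.
  move: vz; apply: negligibleS => t /= nst st; apply: nst => /andP[t0 _].
  have [w zw Hw] := st (ltW t0); exists w => // rz; apply: le_trans Hw _.
  have : k = m * (r - nu) by rewrite /r addrK mulrC divfK// gt_eqF.
  move: rz; rewrite /q; move: (norm2 (z t)) => x rx ->.
  have x0 : 0 < x by exact: lt_trans rx.
  have : 0 <= (m * nu) * (x - r) by rewrite !mulr_ge0// ?subr_ge0 ltW.
  have : 0 <= m * x * (x - r) by rewrite !mulr_ge0// ?subr_ge0 ltW.
  by lra.
have := sqr_norm_decrease (ltW T0) (ltW q0) (acz T (ltW T0)) away vzq.
rewrite leNgt => /negP; apply; apply: (@lt_le_trans _ _ 0); last exact: sqr_ge0.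
rewrite subr0 /T mulrDr mulr1 mulrCA mulfV ?gt_eqF ?mulr_gt0// mulr1.
by move: (norm2 _ ^+ 2) => x; lra.
Qed.

End Lyapunov.

(** * Diagonal matrices and the spectral gap of a graph *)

Section DiagonalMatrices.
Variable R : realType.

Lemma maxf_ge (I : finType) (f : I -> R) i : f i <= maxf f.
Proof.
apply: ub_le_sup; last by exists i.
exists (\sum_j `|f j|) => _ [j _ <-]; rewrite (le_trans (ler_norm _))//.
by rewrite (bigD1 j)//= lerDl sumr_ge0.
Qed.

Lemma maxf_attained (I : finType) (f : I -> R) (i0 : I) :
  exists i, maxf f = f i.
Proof.
have [i _ Hi] := @arg_maxP _ _ _ i0 xpredT f isT.
exists i; apply/eqP; rewrite eq_le maxf_ge andbT; apply: ge_sup.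
  by exists (f i0), i0.
by move=> _ [j _ <-]; exact: Hi.
Qed.

Lemma bform_diag n (d x y : 'rV[R]_n) :
  bform (diag_mx d) x y = \sum_j d 0 j * (x 0 j * y 0 j).
Proof.
rewrite /bform mul_mx_diag mxE; apply: eq_bigr => j _.
by rewrite !mxE mulrCA mulrA.
Qed.

Lemma is_diag_mxE n (A : 'M[R]_n) : is_diag_mx A ->
  A = diag_mx (\row_j A j j).
Proof.
move=> /is_diag_mxP dA; apply/matrixP => i j; rewrite !mxE.
by have [->|ij] := eqVneq i j; rewrite ?mulr1n// mulr0n dA.
Qed.

Lemma negdef_diag_lt0 n (d : 'rV[R]_n) j : negdef (diag_mx d) -> d 0 j < 0.
Proof.
move=> /(_ (delta_mx 0 j)); rewrite bform_diag (bigD1 j)//= big1 => [|i ij].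
  rewrite !mxE !eqxx !mulr1 addr0; apply; apply/eqP => /rowP/(_ j).
  by rewrite !mxE !eqxx => /eqP; rewrite oner_eq0.
by rewrite !mxE (negPf ij) andbF mul0r mulr0.
Qed.

Lemma eigenvalue_diag n (d : 'rV[R]_n) k :
  eigenvalue (diag_mx d) k <-> exists j, k = d 0 j.
Proof.
split=> [/eigenvalueP[v vd /rV0Pn[j vj]]|[j ->]].
  exists j; move/rowP/(_ j): vd; rewrite mul_mx_diag !mxE mulrC.
  by move/(mulIf vj).
apply/eigenvalueP; exists (delta_mx 0 j).
  apply/rowP => i; rewrite mul_mx_diag !mxE eqxx /=.
  by have [->|ij] := eqVneq i j; rewrite ?mul1r ?mulr1// mul0r mulr0.
by apply/rV0Pn; exists j; rewrite !mxE !eqxx oner_eq0.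
Qed.

Lemma lambda_max_diag n (d : 'rV[R]_n) : lambda_max (diag_mx d) = maxf (d 0).
Proof.
rewrite /lambda_max /maxf; congr sup; apply/seteqP; split => k /=.
  by move/eigenvalue_diag => [j ->]; exists j.
by move=> [j _ <-]; apply/eigenvalue_diag; exists j.
Qed.

End DiagonalMatrices.

Lemma cvg_sum (R : realType) (T : Type) (F : set_system T) (I : finType)
    (f : I -> T -> R) (l : I -> R) {FF : Filter F} : (forall i, f i @ F --> l i) ->
  (fun y => \sum_i f i y) @ F --> \sum_i l i.
Proof.
by move=> fl; apply: (@cvg_big _ _ _ _ _ (@add_continuous R^o)) => // i _.
Qed.

Section GraphLaplacian.
Variables (R : realType) (N : nat) (a : 'M[R]_N).
Hypothesis (a_weights : weights a) (a_connected : graph_connected a).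
Implicit Types u v w : 'rV[R]_N.

Let L := laplacian a.

Lemma mul_laplacianE u j : (u *m L) 0 j = \sum_i a i j * (u 0 j - u 0 i).
Proof.
rewrite mxE (bigD1 j)//= [RHS](bigD1 j)//= subrr mulr0 add0r.
rewrite !mxE eqxx mulr_sumr -big_split /=; apply: eq_bigr => i ij.
by rewrite !mxE (negPf ij) (a_weights.2 j i); ring.
Qed.

(** Each edge is counted from both of its ends, hence the factor 1/2. *)
Lemma dot_laplacian u v :
  dot v (u *m L) = 2^-1 * \sum_i \sum_j a i j * (u 0 i - u 0 j) * (v 0 i - v 0 j).
Proof.
pose T := \sum_i \sum_j a i j * (u 0 i - u 0 j) * v 0 i.
have T1 : dot v (u *m L) = T.
  apply: eq_bigr => i _; rewrite mul_laplacianE mulr_sumr; apply: eq_bigr => j _.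
  by rewrite (a_weights.2 j i); ring.
have T2 : \sum_i \sum_j a i j * (u 0 i - u 0 j) * v 0 j = - T.
  rewrite exchange_big /= -sumrN; apply: eq_bigr => i _.
  by rewrite -sumrN; apply: eq_bigr => j _; rewrite (a_weights.2 j i); ring.
have -> : \sum_i \sum_j a i j * (u 0 i - u 0 j) * (v 0 i - v 0 j) = T - - T.
  rewrite -T2 -sumrB; apply: eq_bigr => i _; rewrite -sumrB.
  by apply: eq_bigr => j _; rewrite mulrBr.
by rewrite T1 opprK -mulr2n -[T *+ 2]mulr_natl mulKf// pnatr_eq0.
Qed.

Lemma dot_laplacianC u v : dot v (u *m L) = dot u (v *m L).
Proof.
rewrite !dot_laplacian; congr (_ * _); apply: eq_bigr => i _.
by apply: eq_bigr => j _; ring.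
Qed.

Lemma dot_laplacian_ge0 u : 0 <= dot u (u *m L).
Proof.
rewrite dot_laplacian mulr_ge0//; apply: sumr_ge0 => i _; apply: sumr_ge0 => j _.
by rewrite -mulrA -expr2 mulr_ge0 ?sqr_ge0// (a_weights.1).
Qed.

Definition total u : R := \sum_i u 0 i.

Definition zero_sum u := total u = 0.

Lemma totalD u v : total (u + v) = total u + total v.
Proof. by rewrite -big_split; apply: eq_bigr => i _; rewrite mxE. Qed.

Lemma totalZ k u : total (k *: u) = k * total u.
Proof. by rewrite mulr_sumr; apply: eq_bigr => i _; rewrite mxE. Qed.

Lemma totalB u v : total (u - v) = total u - total v.
Proof. by rewrite totalD -scaleN1r totalZ mulN1r. Qed.

Lemma zero_sum_laplacian u : zero_sum (u *m L).
Proof.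
have := dot_laplacian u (const_mx 1).
have -> : dot (const_mx 1) (u *m L) = total (u *m L).
  by apply: eq_bigr => i _; rewrite [const_mx _ _ _]mxE mul1r.
rewrite /zero_sum => ->; rewrite big1 ?mulr0// => i _; rewrite big1// => j _.
by rewrite !mxE subrr mulr0.
Qed.

(** The form vanishes only if u is constant along edges, hence constant by
    connectedness; and a constant vector of zero sum is 0. *)
Lemma dot_laplacian_eq0 u : zero_sum u -> dot u (u *m L) = 0 -> u = 0.
Proof.
move=> su; rewrite dot_laplacian => /eqP.
rewrite mulf_eq0 invr_eq0 pnatr_eq0 /= psumr_eq0 => [/allP H|i _]; last first.
  apply: sumr_ge0 => j _.
  by rewrite -mulrA -expr2 mulr_ge0 ?sqr_ge0// (a_weights.1).
have edge_eq i j : edge a i j -> u 0 i = u 0 j.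
  move=> /andP[_ aij]; have := H i (mem_index_enum i); rewrite /= psumr_eq0.
    move=> /allP /(_ j (mem_index_enum j)); rewrite /= -mulrA mulf_eq0.
    by rewrite gt_eqF//= mulf_eq0 orbb subr_eq0 => /eqP.
  by move=> k _; rewrite -mulrA -expr2 mulr_ge0 ?sqr_ge0// (a_weights.1).
have path_eq i p : path (edge a) i p -> u 0 i = u 0 (last i p).
  by elim: p i => //= k p IH i /andP[/edge_eq -> /IH].
have const i j : u 0 i = u 0 j.
  by have /connectP[p /path_eq + ->] := a_connected i j.
apply/rowP => i; rewrite mxE; apply/eqP.
have : total u = N%:R * u 0 i.
  rewrite /total (eq_bigr (fun=> u 0 i)) => [|j _]; last exact: const.
  by rewrite sumr_const card_ord mulr_natl.
rewrite su => /esym/eqP; rewrite mulf_eq0 pnatr_eq0 => /orP[/eqP N0|//].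
by have := ltn_ord i; rewrite [X in (_ < X)%N]N0.
Qed.

Lemma continuous_entry j : continuous (fun u : 'rV[R]_N => u 0 j).
Proof. exact: coord_continuous. Qed.

Lemma continuous_laplacian_form : continuous (fun u => dot u (u *m L)).
Proof.
have -> : (fun u => dot u (u *m L)) = (fun u => 2^-1 *
    \sum_i \sum_j a i j * (u 0 i - u 0 j) * (u 0 i - u 0 j)).
  by apply/funext => u; rewrite dot_laplacian.
suff H (u : 'rV[R]_N) : (fun v : 'rV[R]_N => 2^-1 *
    \sum_i \sum_j a i j * (v 0 i - v 0 j) * (v 0 i - v 0 j)) @ u -->
    2^-1 * \sum_i \sum_j a i j * (u 0 i - u 0 j) * (u 0 i - u 0 j) by exact: H.
have H i j : (fun v : 'rV[R]_N => v 0 i - v 0 j) @ u --> u 0 i - u 0 j.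
  exact: (cvgB (@continuous_entry i u) (@continuous_entry j u)).
have K i j : (fun v : 'rV[R]_N => a i j * (v 0 i - v 0 j) * (v 0 i - v 0 j)) @ u
    --> a i j * (u 0 i - u 0 j) * (u 0 i - u 0 j).
  exact: (cvgM (cvgMr (H i j)) (H i j)).
exact: cvgMr (cvg_sum (fun i => cvg_sum (K i))).
Qed.

Lemma compact_zero_sum_sphere : compact [set u : 'rV[R]_N | zero_sum u /\ dot u u = 1].
Proof.
apply: bounded_closed_compact.
  exists 1; split => // k k1 u [_ /= uu]; apply: le_trans (ler_norm_norm2 u) _.
  by rewrite norm2_sqrt_dot uu sqrtr1 ltW.
have csum (u : 'rV[R]_N) : (fun v : 'rV[R]_N => \sum_i v 0 i) @ u --> \sum_i u 0 i.
  exact: cvg_sum (fun i => @continuous_entry i u).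
have cdot (u : 'rV[R]_N) : (fun v : 'rV[R]_N => dot v v) @ u --> dot u u.
  exact: cvg_sum (fun i => cvgM (@continuous_entry i u) (@continuous_entry i u)).
apply: (@closedI _ [set u | zero_sum u] [set u | dot u u = 1]).
  apply: (@preimage_closed _ _ (fun u : 'rV[R]_N => \sum_i u 0 i) [set x | x = 0]).
    by move=> u _; exact: csum.
  exact: closed_eq.
apply: (@preimage_closed _ _ (fun u : 'rV[R]_N => dot u u) [set x | x = 1]).
  by move=> u _; exact: cdot.
exact: closed_eq.
Qed.

(** The minimum of the Rayleigh quotient on the vectors of zero sum is positive
    and is attained at an eigenvector: at a minimiser v the first variation
    [v L - mu v] is orthogonal to all vectors of zero sum and is itself one. *)
Lemma laplacian_gap : (1 < N)%N -> exists2 mu, 0 < mu &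
  (exists2 v : 'rV[R]_N, v != 0 & v *m L = mu *: v) /\
  (forall u, zero_sum u -> mu * dot u u <= dot u (u *m L)).
Proof.
move=> N1; pose S := [set u : 'rV[R]_N | zero_sum u /\ dot u u = 1].
have unit u : zero_sum u -> u != 0 -> S ((norm2 u)^-1 *: u).
  move=> su u0; have nu : norm2 u != 0 by apply: contra_neq u0 => /norm2_eq0.
  split.
    by rewrite /zero_sum totalZ su mulr0.
  by rewrite dotZl dotZr -sqr_norm2 expr2 mulKf// mulVf.
have S0 : S !=set0.
  pose i0 : 'I_N := Ordinal (ltnW N1); pose i1 : 'I_N := Ordinal N1.
  pose d : 'rV[R]_N := delta_mx 0 i0 - delta_mx 0 i1.
  have sdelta k : total (delta_mx 0 k) = 1.
    rewrite /total (bigD1 k)//= big1 ?mxE ?eqxx ?addr0// => i ik.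
    by rewrite mxE (negPf ik).
  exists ((norm2 d)^-1 *: d); apply: unit.
    by rewrite /zero_sum totalB !sdelta subrr.
  by apply/rV0Pn; exists i0; rewrite !mxE eqxx /= subr0 oner_eq0.
have [v + vmin] := EVT_min_rV S0 compact_zero_sum_sphere
  (continuous_subspaceT continuous_laplacian_form).
rewrite inE => -[sv vv]; pose m := dot v (v *m L).
have ray u : zero_sum u -> m * dot u u <= dot u (u *m L).
  move=> su; have [->|u0] := eqVneq u 0; first by rewrite !dot0l mulr0.
  have nu : 0 < norm2 u.
    by rewrite lt0r norm2_ge0 andbT; apply: contra_neq u0 => /norm2_eq0.
  have /vmin : (norm2 u)^-1 *: u \in S by rewrite inE; exact: unit.
  rewrite -scalemxAl dotZl dotZr -/m -(sqr_norm2 u) mulrA -invfM -expr2.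
  by rewrite mulrC ler_pdivlMr// exprn_gt0.
have v0 : v != 0.
  by apply: contra_eq_neq vv => ->; rewrite dot0l eq_sym oner_eq0.
have m0 : 0 < m.
  rewrite lt0r dot_laplacian_ge0 andbT; apply: contra_neq v0.
  exact: dot_laplacian_eq0.
exists m => //; split => //; exists v => //.
have [w wE] : exists w, w = v *m L - m *: v by eexists.
have vLw : v *m L = w + m *: v by rewrite wE subrK.
have sw : zero_sum w.
  by rewrite wE /zero_sum totalB totalZ zero_sum_laplacian sv mulr0 subrr.
suff w0 : dot w w = 0.
  apply/eqP; rewrite -subr_eq0 -wE; apply/eqP/norm2_eq0.
  by rewrite norm2_sqrt_dot w0 sqrtr0.
pose q := dot w (w *m L) - m * dot w w.
have q0 : 0 <= q by rewrite subr_ge0 ray.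
(* The Rayleigh inequality at v + s w, whose terms of order 0 cancel. *)
have var s : 0 <= 2 * s * dot w w + s ^+ 2 * q.
  have : zero_sum (v + s *: w).
    by rewrite /zero_sum totalD totalZ sv sw mulr0 addr0.
  move=> /ray; rewrite -subr_ge0 mulmxDl -scalemxAl.
  rewrite !dotDl !dotDr !dotZl !dotZr (dot_laplacianC w v) (dotC w v) -/m.
  have -> : dot w (v *m L) = dot w w + m * dot v w.
    by rewrite vLw dotDr dotZr (dotC w v).
  rewrite vv /q; congr (0 <= _); ring.
apply/eqP; rewrite eq_le dotxx_ge0 andbT leNgt; apply/negP => w0.
have := var (- (dot w w / (q + 1))).
have q1 : 0 < q + 1 by rewrite ltr_wpDl.
set x := dot w w / (q + 1); have x0 : 0 < x by rewrite divr_gt0.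
have -> : dot w w = x * (q + 1) by rewrite divfK// gt_eqF.
rewrite leNgt => /negP; apply.
have : 0 < x ^+ 2 by rewrite exprn_gt0.
by nra.
Qed.

Lemma mxtens_sum p q (F : 'I_(p * q) -> R) :
  \sum_k F k = \sum_i \sum_l F (mxtens_index (i, l)).
Proof.
rewrite pair_bigA /= (reindex (@mxtens_index p q)) /=.
  by apply: eq_bigr => -[].
by exists (@mxtens_unindex p q) => k _; rewrite ?mxtens_indexK ?mxtens_unindexK.
Qed.

Lemma mul_tens_diag q (d : 'rV[R]_q) (x : 'rV[R]_(N * q)) j l :
  (x *m (L *t diag_mx d)) 0 (mxtens_index (j, l)) =
  d 0 l * ((\row_i x 0 (mxtens_index (i, l))) *m L) 0 j.
Proof.
rewrite mxE mxtens_sum mxE mulr_sumr; apply: eq_bigr => i _.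
rewrite (bigD1 l)//= big1 => [|k kl]; rewrite tensmxE !mxE ?eqxx ?mulr1n.
  by rewrite addr0; ring.
by rewrite (negPf kl) mulr0n !mulr0.
Qed.

(** The nonzero eigenvalues of the Kronecker product are the products of a
    nonzero eigenvalue of L and an entry of d; so the smallest is the gap of L
    times the least entry of d. *)
Lemma lambda2_tens_diag q (d : 'rV[R]_q) : (1 < N)%N -> (0 < q)%N ->
  (forall l, 0 < d 0 l) ->
  0 < lambda2 (L *t diag_mx d) /\
  forall l u, zero_sum u ->
    lambda2 (L *t diag_mx d) * dot u u <= d 0 l * dot u (u *m L).
Proof.
move=> N1 q0 d0; have [m m0 [[v v0 vL] ray]] := laplacian_gap N1.
pose E := [set k | eigenvalue (L *t diag_mx d) k /\ k != 0].
have [l0 _ l0min] := @arg_minP _ _ _ (Ordinal q0) xpredT (d 0) isT.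
have Elb : lbound E (m * d 0 l0).
  move=> k [/eigenvalueP[x xE x0] k0].
  have /rV0Pn[j xj] := x0; case: (mxtens_indexP j) xj => i l xil.
  pose u := \row_i x 0 (mxtens_index (i, l)).
  have uL : d 0 l *: (u *m L) = k *: u.
    apply/rowP => j'; rewrite [LHS]mxE -mul_tens_diag xE.
    by rewrite [RHS]mxE [u _ _]mxE mxE.
  have u0 : 0 < dot u u.
    rewrite lt0r dotxx_ge0 andbT; apply: contra_neq xil => uu.
    have nu : norm2 u = 0 by rewrite norm2_sqrt_dot uu sqrtr0.
    by have /rowP/(_ i) := norm2_eq0 nu; rewrite !mxE.
  have su : zero_sum u.
    by apply: (mulfI k0); rewrite -totalZ -uL totalZ zero_sum_laplacian !mulr0.
  have := ray u su; rewrite -(ler_pM2l (d0 l)) -[leRHS]dotZr uL dotZr.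
  rewrite mulrA ler_pM2r// mulrC; apply: le_trans.
  by rewrite ler_pM2l// l0min.
have Em l : E (m * d 0 l).
  split; last by rewrite gt_eqF// mulr_gt0.
  apply/eigenvalueP.
  pose x : 'rV[R]_(N * q) := \row_k (v 0 (mxtens_unindex k).1 *
     (l == (mxtens_unindex k).2)%:R).
  exists x; last first.
    have /rV0Pn[i vi] := v0; apply/rV0Pn; exists (mxtens_index (i, l)).
    by rewrite mxE mxtens_indexK eqxx mulr1.
  apply/rowP => k; case: (mxtens_indexP k) => {k} j l'.
  rewrite mul_tens_diag [RHS]mxE [x _ _]mxE mxtens_indexK /=.
  have -> : \row_i x 0 (mxtens_index (i, l')) = (l == l')%:R *: v.
    by apply/rowP => i; rewrite !mxE mxtens_indexK /= mulrC.
  rewrite -scalemxAl vL !mxE; case: eqP => [->|_]; first by ring.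
  by rewrite !(mul0r, mulr0).
split.
  apply: lt_le_trans (lb_le_inf _ Elb); first exact: mulr_gt0.
  by exists (m * d 0 l0).
move=> l u su; apply: (@le_trans _ _ (m * d 0 l * dot u u)).
  rewrite ler_wpM2r ?dotxx_ge0//; apply: ge_inf (Em l).
  by exists (m * d 0 l0).
by rewrite -mulrA mulrCA ler_pM2l// ray.
Qed.

End GraphLaplacian.

(** * Nodes, mean and error *)

Section Nodes.
Variables (R : realType) (N n : nat).
Implicit Types (x y v : 'rV[R]_(N * n)) (i j : 'I_N).

Lemma nodeD x y i : node (x + y) i = node x i + node y i.
Proof. by apply/rowP => l; rewrite !nodeE !mxE. Qed.

Lemma nodeZ k x i : node (k *: x) i = k *: node x i.
Proof. by apply/rowP => l; rewrite !nodeE !mxE. Qed.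

Lemma nodeB x y i : node (x - y) i = node x i - node y i.
Proof. by apply/rowP => l; rewrite !nodeE !mxE. Qed.

Lemma node_stack (F : 'I_N -> 'rV[R]_n) i : node (stack F) i = F i.
Proof. by rewrite /node /stack mxvecK rowK. Qed.

Lemma node_inj x y : (forall i, node x i = node y i) -> x = y.
Proof.
move=> xy; apply/rowP => k; case/mxvec_indexP: k => i l.
by have /rowP/(_ l) := xy i; rewrite !nodeE.
Qed.

Lemma dot_node x y : dot x y = \sum_i dot (node x i) (node y i).
Proof.
rewrite /dot (reindex _ (curry_mxvec_bij N n)) /= pair_bigA /=.
by apply: eq_bigr => -[i l] _ /=; rewrite !nodeE.
Qed.

Lemma norm2_node_le x i : norm2 (node x i) <= norm2 x.
Proof.
rewrite !norm2_sqrt_dot ler_wsqrtr// (dot_node x) (bigD1 i)//= lerDl.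
by apply: sumr_ge0 => j _; exact: dotxx_ge0.
Qed.

(** Cauchy-Schwarz with the all-ones vector. *)
Lemma sum_norm2_node x : \sum_i norm2 (node x i) <= Num.sqrt N%:R * norm2 x.
Proof.
pose u : 'rV[R]_N := \row_i norm2 (node x i).
have := dot_le_norm2 (const_mx 1) u.
have -> : dot (const_mx 1) u = \sum_i norm2 (node x i).
  by apply: eq_bigr => i _; rewrite !mxE mul1r.
move/le_trans; apply; rewrite ler_pM ?norm2_ge0//.
  rewrite norm2_sqrt_dot /dot (eq_bigr (fun=> 1)) => [|i _].
    by rewrite sumr_const card_ord.
  by rewrite !mxE mulr1.
rewrite [leLHS]norm2_sqrt_dot norm2_sqrt_dot (dot_node x).
rewrite ler_wsqrtr// /dot ler_sum// => i _.
by rewrite mxE -expr2 sqr_norm2.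
Qed.

Lemma node_error x i : node (error x) i = node x i - node_mean x.
Proof. exact: node_stack. Qed.

Lemma error_linear k x y : error (k *: x + y) = k *: error x + error y.
Proof.
apply: node_inj => i; rewrite nodeD nodeZ !node_error nodeD nodeZ.
have -> : node_mean (k *: x + y) = k *: node_mean x + node_mean y.
  rewrite /node_mean (eq_bigr (fun j => k *: node x j + node y j)) => [|j _].
    by rewrite big_split /= -scaler_sumr scalerDr !scalerA mulrC.
  by rewrite nodeD nodeZ.
by rewrite scalerBr opprD addrACA.
Qed.

Lemma errorB x y : error (x - y) = error x - error y.
Proof. by rewrite addrC -scaleN1r error_linear scaleN1r addrC. Qed.

Lemma error_diff x i j :
  node (error x) i - node (error x) j = node x i - node x j.
Proof. by rewrite !node_error opprB addrA subrK. Qed.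

Hypothesis N_gt0 : (0 < N)%N.

Lemma sum_node_error x : \sum_i node (error x) i = 0.
Proof.
rewrite (eq_bigr (fun i => node x i - node_mean x)) => [|i _]; last first.
  exact: node_error.
rewrite sumrB sumr_const card_ord /node_mean -scaler_nat scalerA divff.
  by rewrite scale1r subrr.
by rewrite pnatr_eq0 -lt0n.
Qed.

(** The error map is an orthogonal projection: the errors sum to 0, so they are
    orthogonal to a common mean. *)
Lemma dot_error_error x v : dot (error x) (error v) = dot (error x) v.
Proof.
rewrite !dot_node; under eq_bigr do rewrite (node_error v) dotBr.
by rewrite sumrB -[X in _ - X]dot_suml sum_node_error dot0l subr0.
Qed.

Lemma norm2_error_le x : norm2 (error x) <= norm2 x.
Proof.
have [->|e0] := eqVneq (norm2 (error x)) 0; first exact: norm2_ge0.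
have ep : 0 < norm2 (error x) by rewrite lt0r e0 norm2_ge0.
rewrite -(ler_pM2l ep) -expr2 sqr_norm2 dot_error_error.
exact: dot_le_norm2.
Qed.

(** |p - q|^2 <= 2 (|p|^2 + |q|^2); the factor 2, where the triangle inequality would
    give 4, leaves room between |e| <= emax / 2 and the range emax of the sector
    condition. *)
Lemma sqr_norm2_node_diff x i j :
  norm2 (node x i - node x j) ^+ 2 <= 2 * norm2 (error x) ^+ 2.
Proof.
have [->|ij] := eqVneq i j.
  by rewrite subrr norm20 expr0n /= mulr_ge0 ?sqr_ge0.
rewrite -error_diff !sqr_norm2 (dot_node (error x)) (bigD1 i)//=.
rewrite (bigD1 j) 1?eq_sym//=.
set S := \sum_(_ | _) _.
have S0 : 0 <= S by apply: sumr_ge0 => k _; exact: dotxx_ge0.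
move: (node _ i) (node _ j) => p q.
have := dotxx_ge0 (p + q).
rewrite !(dotDl, dotDr, dotNl, dotNr) (dotC q p); lra.
Qed.

Lemma norm2_mean_le x : norm2 (node_mean x) <= norm2 x.
Proof.
have Np : 0 < N%:R :> R by rewrite ltr0n.
rewrite /node_mean norm2Z gtr0_norm ?invr_gt0// mulrC ler_pdivrMr//.
apply: (@le_trans _ _ (\sum_i norm2 (node x i))).
  by elim/big_rec2: _ => [|i a b _ H]; rewrite ?norm20//
    (le_trans (ler_norm2D _ _))// lerD2l.
apply: le_trans (ler_sum _ (fun i _ => norm2_node_le x i)) _.
by rewrite sumr_const card_ord mulr_natr.
Qed.

(** The Laplacian acts on the nodes coordinate by coordinate, and the coordinates of
    the error have zero sum: the spectral gap applies to each of them. *)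
Definition coordinate x (l : 'I_n) : 'rV[R]_N := \row_i node x i 0 l.

Lemma dot_coordinate x : dot x x = \sum_l dot (coordinate x l) (coordinate x l).
Proof.
rewrite dot_node exchange_big /=; apply: eq_bigr => l _.
by apply: eq_bigr => i _; rewrite !mxE.
Qed.

Lemma zero_sum_coordinate_error x l : zero_sum (coordinate (error x) l).
Proof.
have /rowP/(_ l) := sum_node_error x.
rewrite summxE [X in _ = X]mxE /zero_sum => <-.
by apply: eq_bigr => i _; rewrite mxE.
Qed.

End Nodes.

Section LocallyBounded.
Variable R : realType.

(** Local boundedness outside an exceptional set; it is stable under the operations
    that assemble a network from its nodes and edges. *)
Definition bounded_off m q (D : set 'rV[R]_m) (x : 'rV[R]_m)
    (F : 'rV[R]_m -> 'rV[R]_q) : Prop :=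
  exists B, \forall y \near x, ~ D y -> norm2 (F y) <= B.

Lemma bounded_off_sum m q (I : finType) (D : set 'rV[R]_m) (x : 'rV[R]_m)
    (F : I -> 'rV[R]_m -> 'rV[R]_q) : (forall i, bounded_off D x (F i)) ->
  bounded_off D x (fun y => \sum_i F i y).
Proof.
move=> /fin_all_exists[B HB]; exists (\sum_i B i).
have : \forall y \near x, forall i, ~ D y -> norm2 (F i y) <= B i.
  exact: (@filter_forall _ _ (fun i y => ~ D y -> norm2 (F i y) <= B i) (nbhs x) _ HB).
apply: filterS => y Hy Dy; elim/big_rec2: _ => [|i b u _ H]; first by rewrite norm20.
by rewrite (le_trans (ler_norm2D _ _))// lerD// Hy.
Qed.

Lemma bounded_offD m q (D : set 'rV[R]_m) (x : 'rV[R]_m)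
    (F G : 'rV[R]_m -> 'rV[R]_q) : bounded_off D x F -> bounded_off D x G ->
  bounded_off D x (fun y => F y + G y).
Proof.
move=> [B HB] [C HC]; exists (B + C); move: HB HC; apply: filterS2 => y FB GC Dy.
by rewrite (le_trans (ler_norm2D _ _))// lerD ?FB ?GC.
Qed.

Lemma bounded_offZ m q (D : set 'rV[R]_m) (x : 'rV[R]_m) k
    (F : 'rV[R]_m -> 'rV[R]_q) : bounded_off D x F ->
  bounded_off D x (fun y => k *: F y).
Proof.
move=> [B HB]; exists (`|k| * B); move: HB; apply: filterS => y FB Dy.
by rewrite norm2Z ler_wpM2l// FB.
Qed.

Lemma bounded_off_stack N m q (D : set 'rV[R]_m) (x : 'rV[R]_m)
    (F : 'I_N -> 'rV[R]_m -> 'rV[R]_q) : (forall i, bounded_off D x (F i)) ->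
  bounded_off D x (fun y => stack (F^~ y)).
Proof.
move=> /fin_all_exists[B HB]; exists (Num.sqrt (\sum_i B i ^+ 2)).
have : \forall y \near x, forall i, ~ D y -> norm2 (F i y) <= B i.
  exact: (@filter_forall _ _ (fun i y => ~ D y -> norm2 (F i y) <= B i) (nbhs x) _ HB).
apply: filterS => y Hy Dy; rewrite norm2_sqrt_dot ler_wsqrtr// dot_node.
apply: ler_sum => i _; rewrite node_stack -sqr_norm2.
by rewrite ler_pXn2r ?nnegrE ?norm2_ge0 ?(le_trans (norm2_ge0 _) (Hy i Dy)) ?Hy.
Qed.

Lemma bounded_off_comp m q r (D : set 'rV[R]_m) (E : set 'rV[R]_q) (x : 'rV[R]_m)
    (l : 'rV[R]_m -> 'rV[R]_q) (F : 'rV[R]_q -> 'rV[R]_r) (C : R) : 0 < C ->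
  (forall y, norm2 (l y - l x) <= C * norm2 (y - x)) ->
  (forall y, E (l y) -> D y) ->
  (exists d B, 0 < d /\ forall z, ball2 (l x) d z -> ~ E z -> norm2 (F z) <= B) ->
  bounded_off D x (F \o l).
Proof.
move=> C0 lC ED [d [B [d0 HB]]]; exists B.
apply: filterS (nbhs_ball2 x (divr_gt0 d0 C0)) => y yx Dy; apply: HB.
  apply: le_lt_trans (lC y) _.
  by move: yx; rewrite /ball2 /= ltr_pdivlMr// mulrC.
by move=> /ED.
Qed.

End LocallyBounded.

(** * Estimates for the network field *)

Section NetworkEstimates.
Variables (R : realType) (N n : nat).
Variables (a : 'M[R]_N) (a_weights : weights a).
Variables (f h g : 'I_N -> R -> 'rV[R]_n -> 'rV[R]_n).
Variables (eta : R -> 'rV[R]_n -> 'rV[R]_n) (c : R).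
Hypothesis fE : forall i t x, 0 <= t -> f i t x = h i t x + g i t x.
Hypothesis eta_odd : forall t v, 0 <= t -> eta t (- v) = - eta t v.
Local Notation net := (network f a eta c).

Lemma odd_at0 t : 0 <= t -> eta t 0 = 0.
Proof.
move=> t0; have /eqP := eta_odd 0 t0; rewrite oppr0 -addr_eq0 => H.
have : 2 *: eta t 0 = 0 by apply/eqP; rewrite scaler_nat mulr2n.
by move/eqP; rewrite scaler_eq0 pnatr_eq0 => /eqP.
Qed.

(** The exceptional sets of the nodes and of the edges pull back to null sets of the
    state space; off their union every constituent of the network takes a Filippov
    value of its own field. This replaces a calculus of Filippov maps for sums and
    products. *)
Lemma network_regular : (0 < N * n)%N ->
  (forall i, continuous_or_pws (h i)) -> (forall i, continuous_or_pws (g i)) ->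
  continuous_or_pws eta ->
  exists D : set 'rV[R]_(N * n),
    [/\ null_set D,
        forall t y, 0 <= t -> ~ D y ->
          [/\ forall i, filippov (h i) t (node y i) (h i t (node y i)),
              forall i, filippov (g i) t (node y i) (g i t (node y i)) &
              forall i j, i != j -> filippov eta t (node y i - node y j)
                                      (eta t (node y i - node y j))] &
        forall t x, 0 <= t -> bounded_off D x (net t)].
Proof.
move=> Nn hr gr er; have n0 : (0 < n)%N by move: Nn; rewrite muln_gt0 => /andP[].
have /choice[Dh HDh] i :=
  piecewise_continuous_filippov (regular_piecewise_continuous n0 (hr i)).
have /choice[Dg HDg] i :=
  piecewise_continuous_filippov (regular_piecewise_continuous n0 (gr i)).
have [De [De0 Hef _ Heb]] :=
  piecewise_continuous_filippov (regular_piecewise_continuous n0 er).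
pose D1 : set 'rV[R]_(N * n) := \bigcup_i [set y | Dh i (node y i)].
pose D2 : set 'rV[R]_(N * n) := \bigcup_i [set y | Dg i (node y i)].
pose D3 : set 'rV[R]_(N * n) := \bigcup_(p : 'I_N * 'I_N)
  [set y | p.1 != p.2 /\ De (node y p.1 - node y p.2)].
exists (D1 `|` (D2 `|` D3)); split.
- apply: null_setU => //; last apply: null_setU => //.
  + by apply: null_bigcup => // i; apply: null_node => //; have [] := HDh i.
  + by apply: null_bigcup => // i; apply: null_node => //; have [] := HDg i.
  + apply: null_bigcup => // -[i j] /=; have [->|ij] := eqVneq i j.
      by apply: sub_null_set (null_set0 R Nn) => y [].
    by apply: sub_null_set (null_node_diff ij Nn De0) => y [].
- move=> t y t0 Dy; split=> [i|i|i j ij].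
  + have [_ + _ _] := HDh i; apply => // Di; apply: Dy; left; by exists i.
  + have [_ + _ _] := HDg i; apply => // Di; apply: Dy; right; left; by exists i.
  + by apply: Hef => // Di; apply: Dy; right; right; exists (i, j).
move=> t x t0; set D := _ `|` _.
apply: (bounded_off_stack (F := fun i y => f i t (node y i) -
  c *: \sum_j a i j *: eta t (node y i - node y j))) => i.
have -> : (fun y : 'rV[R]_(N * n) => f i t (node y i) -
    c *: \sum_j a i j *: eta t (node y i - node y j)) = (fun y =>
    (h i t (node y i) + g i t (node y i)) +
    (- c) *: \sum_j a i j *: eta t (node y i - node y j)).
  by apply/funext => y; rewrite fE// scaleNr.
have node1 (y : 'rV[R]_(N * n)) k : norm2 (node y k - node x k) <= 1 * norm2 (y - x).
  by rewrite -nodeB mul1r norm2_node_le.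
apply: bounded_offD; first apply: bounded_offD.
- have [_ _ _ Hb] := HDh i.
  apply: (bounded_off_comp (E := Dh i) (l := fun y => node y i) ltr01) (Hb t _ t0) => //.
  by move=> y Dy; left; exists i.
- have [_ _ _ Hb] := HDg i.
  apply: (bounded_off_comp (E := Dg i) (l := fun y => node y i) ltr01) (Hb t _ t0) => //.
  by move=> y Dy; right; left; exists i.
apply/bounded_offZ/bounded_off_sum => j; apply: bounded_offZ.
have [<-|ij] := eqVneq i j.
  exists 0; apply: filterS (nbhs_ball2 x ltr01) => y _ _.
  by rewrite subrr odd_at0// norm20.
apply: (bounded_off_comp (E := De) (l := fun y => node y i - node y j) (C := 2))
  (Heb t _ t0) => //.
  move=> y; rewrite opprD addrACA -opprD.
  have -> : node y i - node x i - (node y j - node x j) =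
      node (y - x) i - node (y - x) j by rewrite !nodeB.
  rewrite (le_trans (ler_norm2D _ _))// norm2N mulrDl mul1r lerD//;
  exact: norm2_node_le.
by move=> y Dy; right; right; exists (i, j).
Qed.

(** Each edge contributes twice to the coupling, with opposite signs. *)
Lemma antisymmetric_coupling (p : 'I_N -> 'rV[R]_n) (E : 'I_N -> 'I_N -> 'rV[R]_n) :
  (forall i j, E j i = - E i j) ->
  \sum_i dot (p i) (\sum_j a i j *: E i j) =
  2^-1 * \sum_i \sum_j a i j * dot (p i - p j) (E i j).
Proof.
move=> EN; pose T := \sum_i \sum_j a i j * dot (p i) (E i j).
have T2 : \sum_i \sum_j a i j * dot (p j) (E i j) = - T.
  rewrite exchange_big /= -sumrN; apply: eq_bigr => i _.
  by rewrite -sumrN; apply: eq_bigr => j _; rewrite EN dotNr a_weights.2 mulrN.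
have -> : \sum_i \sum_j a i j * dot (p i - p j) (E i j) = T - - T.
  rewrite -T2 -sumrB; apply: eq_bigr => i _; rewrite -sumrB.
  by apply: eq_bigr => j _; rewrite dotBl mulrBr.
rewrite opprK -mulr2n -[T *+ 2]mulr_natl mulKf ?pnatr_eq0//.
apply: eq_bigr => i _; rewrite dot_sumr; apply: eq_bigr => j _.
by rewrite dotZr.
Qed.

Lemma dot_network t (p y : 'rV[R]_(N * n)) : 0 <= t ->
  dot p (net t y) =
    \sum_i (dot (node p i) (h i t (node y i)) + dot (node p i) (g i t (node y i))) -
    c * (2^-1 * \sum_i \sum_j a i j *
      dot (node p i - node p j) (eta t (node y i - node y j))).
Proof.
move=> t0; rewrite -(antisymmetric_coupling (node p)
    (E := fun i j => eta t (node y i - node y j))); last first.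
  by move=> i j; rewrite -eta_odd// opprB.
rewrite mulr_sumr -sumrB dot_node; apply: eq_bigr => i _.
by rewrite node_stack dotBr dotZr fE// dotDr.
Qed.

Variables (W : 'I_N -> 'M[R]_n) (M : 'I_N -> R) (upsilon : 'rV[R]_n) (emax : R).
Hypothesis c_ge0 : 0 <= c.
Hypothesis h_quad : forall i, quad 1%:M (W i) (h i).
Hypothesis g_bound : forall i t x v, 0 <= t -> filippov (g i) t x v -> norm2 v < M i.
Hypothesis eta_sector : forall t z v, 0 <= t -> norm2 z <= emax ->
  filippov eta t z v -> bform (diag_mx upsilon) z z <= bform 1%:M z v.

(** The deviations p from a common point q: the internal dynamics contract towards
    q up to the values of the fields at q, and the coupling acts through the
    differences of the p's, which are those of the states. Both estimates of the
    theorem are instances, with q = 0 and with q the mean of the nodes. *)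
Lemma dot_network_le t (p y : 'rV[R]_(N * n)) (q : 'rV[R]_n) (H : R) : 0 <= t ->
  0 <= maxf M + H ->
  (forall i, node p i = node y i - q) ->
  (forall i j, norm2 (node y i - node y j) <= emax) ->
  (forall i, exists2 v, filippov (h i) t q v & norm2 v <= H) ->
  (forall i, filippov (h i) t (node y i) (h i t (node y i))) ->
  (forall i, filippov (g i) t (node y i) (g i t (node y i))) ->
  (forall i j, i != j -> filippov eta t (node y i - node y j)
                           (eta t (node y i - node y j))) ->
  dot p (net t y) <=
    \sum_i bform (W i) (node p i) (node p i) +
    (maxf M + H) * (Num.sqrt N%:R * norm2 p) -
    c * \sum_l upsilon 0 l *
          dot (coordinate p l) (coordinate p l *m laplacian a).
Proof.
move=> t0 MH pE ye qH yh yg yeta; rewrite dot_network//; apply: lerB.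
  apply: (@le_trans _ _ (\sum_i bform (W i) (node p i) (node p i) +
      (maxf M + H) * \sum_i norm2 (node p i))); last first.
    by rewrite lerD2l ler_wpM2l// sum_norm2_node.
  rewrite mulr_sumr -big_split; apply: ler_sum => i _ /=.
  have [v hv vH] := qH i.
  have := h_quad t0 (yh i) hv; rewrite bform1 dotBr -pE => Hh.
  have := dot_le_norm2 (node p i) v.
  have := dot_le_norm2 (node p i) (g i t (node y i)).
  have := g_bound t0 (yg i); have := maxf_ge M i; have := norm2_ge0 (node p i).
  move: Hh vH; move: (dot _ _) (dot _ _) (dot _ _) (bform _ _ _) (norm2 v).
  move: (norm2 (g _ _ _)) (norm2 _) (maxf M) (M i) => x1 x2 x3 x4 x5 x6 x7 x8 x9.
  move=> *; have : x2 * x9 <= x2 * H by rewrite ler_wpM2l.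
  have : x2 * x1 <= x2 * x3 by rewrite ler_wpM2l//; lra.
  by lra.
apply: ler_wpM2l => //.
have -> : \sum_l upsilon 0 l * dot (coordinate p l) (coordinate p l *m laplacian a) =
    2^-1 * \sum_i \sum_j a i j *
      bform (diag_mx upsilon) (node p i - node p j) (node p i - node p j).
  under eq_bigr do rewrite dot_laplacian// mulrCA.
  rewrite -mulr_sumr; congr (_ * _).
  under eq_bigr do rewrite mulr_sumr; rewrite exchange_big /=.
  apply: eq_bigr => i _; under eq_bigr do rewrite mulr_sumr.
  rewrite exchange_big /=; apply: eq_bigr => j _.
  rewrite bform_diag mulr_sumr; apply: eq_bigr => l _.
  by rewrite !mxE; ring.
rewrite ler_wpM2l//; apply: ler_sum => i _; apply: ler_sum => j _.
rewrite ler_wpM2l ?a_weights.1//.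
have -> : node p i - node p j = node y i - node y j by rewrite !pE opprB addrA subrK.
have [<-|ij] := eqVneq i j.
  rewrite subrr dot0l bform_diag big1// => l _.
  by rewrite mxE mul0r mulr0.
by rewrite -[leRHS]bform1; exact: (eta_sector t0 (ye i j) (yeta i j ij)).
Qed.

End NetworkEstimates.

Section RadialEstimates.
Variables (R : realType) (N n : nat).
Hypothesis (N_gt0 : (0 < N)%N) (n_gt0 : (0 < n)%N).
Variables (a : 'M[R]_N) (a_weights : weights a).
Variables (f h g : 'I_N -> R -> 'rV[R]_n -> 'rV[R]_n).
Variables (eta : R -> 'rV[R]_n -> 'rV[R]_n) (c : R).
Variables (W : 'I_N -> 'M[R]_n) (M : 'I_N -> R) (upsilon : 'rV[R]_n) (emax : R).
Hypothesis f_quad_affine : forall i, quad_affine 1%:M (W i) (f i) (h i) (g i) (M i).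
Hypothesis W_diag : forall i, is_diag_mx (W i).
Hypothesis eta_regular : continuous_or_pws eta.
Hypothesis eta_odd : forall t v, 0 <= t -> eta t (- v) = - eta t v.
Hypothesis c_ge0 : 0 <= c.
Hypothesis emax_gt0 : 0 < emax.
Hypothesis upsilon_ge0 : forall l, 0 <= upsilon 0 l.
Hypothesis eta_sector : forall t z v, 0 <= t -> norm2 z <= emax ->
  filippov eta t z v -> bform (diag_mx upsilon) z z <= bform 1%:M z v.
Local Notation net := (network f a eta c).

Lemma h_filippov_nonempty i t z : 0 <= t -> filippov (h i) t z !=set0.
Proof.
have [_ hr _ _ _] := f_quad_affine i.
have [D [_ _ + _]] :=
  piecewise_continuous_filippov (regular_piecewise_continuous n_gt0 hr).
exact.
Qed.

Lemma maxM_gt0 : 0 < maxf M.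
Proof.
pose i : 'I_N := Ordinal N_gt0; apply: lt_le_trans (maxf_ge M i).
have [_ _ gr _ gM] := f_quad_affine i.
have [D [_ _ + _]] :=
  piecewise_continuous_filippov (regular_piecewise_continuous n_gt0 gr).
move=> /(_ 0 0 (lexx 0))[v gv]; apply: le_lt_trans (norm2_ge0 v) _.
exact: gM gv.
Qed.

Lemma W_le_wmax i l : W i l l <= maxf (fun i => lambda_max (W i)).
Proof.
apply: le_trans (maxf_ge _ i).
rewrite (is_diag_mxE (W_diag i)) lambda_max_diag; set d := \row_j _.
by rewrite !mxE eqxx mulr1n; have := maxf_ge (d 0) l; rewrite mxE.
Qed.

(** The square of sqrt 2 * 2/3 is below 1: the bound 2/3 leaves room above the
    invariant value 1/2 and still keeps all differences in the sector's range. *)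
Lemma near_sector (x : 'rV[R]_(N * n)) : norm2 (error x) < 2 / 3 * emax ->
  \forall y \near x, forall i j, norm2 (node y i - node y j) <= emax.
Proof.
rewrite -subr_gt0 => ex; apply: filterS (nbhs_ball2 x ex) => y yx i j.
have ey : norm2 (error y) < 2 / 3 * emax.
  have := ler_norm2B (error y) (error x).
  have := norm2_error_le N_gt0 (y - x); rewrite errorB.
  by move: yx; rewrite /ball2 /=; lra.
rewrite -(@ler_pXn2r _ 2)// ?nnegrE ?norm2_ge0 ?(ltW emax_gt0)//.
apply: le_trans (sqr_norm2_node_diff y i j) _.
have := norm2_ge0 (error y); move: ey; move: (norm2 (error y)) => u.
by nra.
Qed.

(** The estimate of [dot_network_le] holds at the states y near x that determine the
    Filippov map, with the factor [l y]; local boundedness carries it over to the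
    Filippov values at x. *)
Lemma network_radial t (x v : 'rV[R]_(N * n)) (l : 'rV[R]_(N * n) -> 'rV[R]_(N * n))
    (q : 'rV[R]_(N * n) -> 'rV[R]_n) (H m : R) : 0 <= t ->
  (forall y z, norm2 (l y - l z) <= norm2 (y - z)) ->
  (forall y i, node (l y) i = node y i - q y) ->
  (\forall y \near x, forall i v, filippov (h i) t (q y) v -> norm2 v <= H) ->
  (forall p y, p = l y ->
    \sum_i bform (W i) (node p i) (node p i) -
    c * \sum_k upsilon 0 k * dot (coordinate p k) (coordinate p k *m laplacian a) <=
    - m * norm2 p ^+ 2) ->
  norm2 (error x) < 2 / 3 * emax -> filippov net t x v ->
  dot (l x) v <= - m * norm2 (l x) ^+ 2 +
                 Num.sqrt N%:R * (maxf M + H) * norm2 (l x).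
Proof.
move=> t0 l1 lq qH lm ex.
have fE i s z : 0 <= s -> f i s z = h i s z + g i s z.
  by have [+ _ _ _ _] := f_quad_affine i; apply.
have [|i|i|D [D0 HD Db]] := network_regular (f := f) (h := h) (g := g) a c fE eta_odd
  _ _ _ eta_regular.
- by rewrite muln_gt0 N_gt0.
- by have [_ + _ _ _] := f_quad_affine i.
- by have [_ _ + _ _] := f_quad_affine i.
have [B HB] := Db t x t0.
have /ball2_nbhs[d d0 Hd] : \forall y \near x, [/\ ~ D y -> norm2 (net t y) <= B,
    forall i v, filippov (h i) t (q y) v -> norm2 v <= H &
    forall i j, norm2 (node y i - node y j) <= emax].
  by move: HB qH (near_sector ex); apply: filterS3 => y.
apply: (filippov_dot_le (l := l) (D := D) (d := d) (B := B)
  (Phi := fun r => - m * r ^+ 2 + Num.sqrt N%:R * (maxf M + H) * r)) => //.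
- apply: cvgD; first by apply: cvgMr; exact: exprn_continuous.
  by apply: cvgMr; exact: cvg_id.
- by move=> y /Hd[].
move=> y /Hd[_ yH ye] Dy; have [hy gy ety] := HD t y t0 Dy.
have qv i : exists2 w, filippov (h i) t (q y) w & norm2 w <= H.
  by have [w hw] := h_filippov_nonempty i (q y) t0; exists w => //; exact: yH hw.
have MH : 0 <= maxf M + H.
  have [w _ wH] := qv (Ordinal N_gt0).
  by rewrite addr_ge0 ?(ltW maxM_gt0)// (le_trans (norm2_ge0 w)).
have hq i : quad 1%:M (W i) (h i) by have [_ _ _ + _] := f_quad_affine i.
have gb i s z w : 0 <= s -> filippov (g i) s z w -> norm2 w < M i.
  by have [_ _ _ _ +] := f_quad_affine i; exact.
have := dot_network_le a_weights fE eta_odd c_ge0 hq gb eta_sector t0 MH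
  (lq y) ye qv hy gy ety.
have := lm (l y) y erefl.
by move: (\sum_i _) (c * _) (dot _ _) (norm2 _) => A C E r; lra.
Qed.

(** The common point is 0, and the coupling only helps. *)
Lemma state_radial t (x v : 'rV[R]_(N * n)) (h0 : R) : 0 <= t ->
  (forall i v, filippov (h i) t 0 v -> norm2 v <= h0) ->
  norm2 (error x) < 2 / 3 * emax -> filippov net t x v ->
  dot x v <= - (- maxf (fun i => lambda_max (W i))) * norm2 x ^+ 2 +
             Num.sqrt N%:R * (maxf M + h0) * norm2 x.
Proof.
move=> t0 hb ex xv.
apply: (@network_radial t x v id (fun=> 0) h0) => //.
- by move=> y i; rewrite subr0.
- by apply: filterS (nbhs_ball2 x ltr01) => y _.
move=> p _ _; rewrite opprK sqr_norm2 lerBlDr.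
apply: ler_wpDr.
  apply: mulr_ge0 => //; apply: sumr_ge0 => l _.
  by rewrite mulr_ge0// dot_laplacian_ge0.
rewrite (dot_node p) mulr_sumr; apply: ler_sum => i _.
rewrite (is_diag_mxE (W_diag i)) bform_diag mulr_sumr; apply: ler_sum => l _.
by rewrite ler_wpM2r -?expr2 ?sqr_ge0// mxE W_le_wmax.
Qed.

(** The common point is the mean of the nodes, whose norm is at most that of the
    state; so the values of the fields there are within the bound hmax. *)
Lemma error_radial t (x v : 'rV[R]_(N * n)) (hmax rmax m : R) : 0 <= t ->
  (forall i z v, norm2 z <= rmax -> filippov (h i) t z v -> norm2 v <= hmax) ->
  (forall l u, zero_sum u ->
     maxf (fun i => W i l l) * dot u u - c * (upsilon 0 l * dot u (u *m laplacian a))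
     <= - m * dot u u) ->
  norm2 x < rmax -> norm2 (error x) < 2 / 3 * emax -> filippov net t x v ->
  dot (error x) v <= - m * norm2 (error x) ^+ 2 +
                     Num.sqrt N%:R * (maxf M + hmax) * norm2 (error x).
Proof.
move=> t0 hb mb xr ex xv.
apply: (@network_radial t x v (@error R N n) (@node_mean R N n) hmax m) => //.
- by move=> y z; rewrite -errorB; exact: norm2_error_le.
- by move=> y i; exact: node_error.
- move: xr; rewrite -subr_gt0 => xr; apply: filterS (nbhs_ball2 x xr) => y yx i w.
  apply: hb; apply: le_trans (norm2_mean_le N_gt0 y) _.
  by move: yx; rewrite /ball2 /=; have := ler_norm2B y x; lra.
move=> p y ->; rewrite sqr_norm2 dot_coordinate !mulr_sumr.
have Wl i : bform (W i) (node (error y) i) (node (error y) i) <=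
    \sum_l maxf (fun i => W i l l) * node (error y) i 0 l ^+ 2.
  rewrite [X in bform X](is_diag_mxE (W_diag i)) bform_diag; apply: ler_sum => l _.
  by rewrite -expr2 ler_wpM2r ?sqr_ge0// mxE (maxf_ge (fun i => W i l l)).
apply: (@le_trans _ _ (\sum_l (maxf (fun i => W i l l) *
    dot (coordinate (error y) l) (coordinate (error y) l) -
    c * (upsilon 0 l * dot (coordinate (error y) l)
      (coordinate (error y) l *m laplacian a))))); last first.
  by apply: ler_sum => l _; apply: mb; exact: zero_sum_coordinate_error.
rewrite sumrB lerD2r; apply: le_trans (ler_sum _ (fun i _ => Wl i)) _.
rewrite exchange_big /= le_eqVlt; apply/orP; left; apply/eqP.
apply: eq_bigr => l _; rewrite -mulr_sumr; congr (_ * _).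
by apply: eq_bigr => i _; rewrite [coordinate _ _ _ _]mxE expr2.
Qed.

End RadialEstimates.

(** * Convergence of the network *)

Section Trapping.
Variable R : realType.
Local Notation mu := (@lebesgue_measure R).

(** Continuous induction: the supremum of the times up to which P holds satisfies P
    by the first hypothesis and could be passed by the second. *)
Lemma continuous_induction (P : R -> Prop) :
  (forall c, 0 <= c -> (forall t, 0 <= t < c -> P t) -> P c) ->
  (forall c, 0 <= c -> P c -> exists2 d, 0 < d & forall t, c <= t < c + d -> P t) ->
  forall t, 0 <= t -> P t.
Proof.
move=> Pclosed Popen t1 t10; apply: contrapT => nP.
pose S := [set t | 0 <= t <= t1 /\ forall s, 0 <= s <= t -> P s].
have P0 : P 0 by apply: Pclosed => // t /andP[t0 /(le_lt_trans t0)]; rewrite ltxx.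
have S0 : S 0.
  split=> [|s]; first by rewrite lexx t10.
  by rewrite -eq_le => /eqP <-.
have supS : has_sup S by split; [exists 0|exists t1 => t [/andP[]]].
pose c := sup S; have c0 : 0 <= c by exact: (ub_le_sup supS.2 S0).
have ct1 : c <= t1 by apply: ge_sup; [exists 0|move=> t [/andP[]]].
have Pc s : 0 <= s < c -> P s.
  move=> /andP[s0]; rewrite -subr_gt0 => sc.
  have [t St] := sup_adherent sc supS; rewrite -/c subKr => st.
  by have [_] := St; apply; rewrite s0 ltW.
have {}Pc s : 0 <= s <= c -> P s.
  move=> /andP[s0]; rewrite le_eqVlt => /predU1P[->|sc]; last by apply: Pc; rewrite s0.
  exact: Pclosed.
have cc : 0 <= c <= c by rewrite c0 lexx.
have [d d0 Pd] := Popen c c0 (Pc c cc).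
have : S (Num.min t1 (c + d / 2)).
  have d2 : 0 < d / 2 by rewrite divr_gt0.
  split=> [|s /andP[s0]].
    by rewrite le_min t10 ge_min lexx addr_ge0// ltW.
  rewrite le_min => /andP[_ sd]; have [sc|cs] := leP s c; first by apply: Pc; rewrite s0.
  by apply: Pd; rewrite ltW//=; lra.
move=> /(ub_le_sup supS.2); rewrite -/c ge_min => /orP[t1c|]; last by move: d0; lra.
by apply: nP; apply: Pc; rewrite t10.
Qed.

Lemma norm2_lt_right p (z : R -> 'rV[R]_p) c r :
  (forall T, 0 <= T -> absolutely_continuous_on 0 T z) -> 0 <= c ->
  norm2 (z c) < r -> exists2 d, 0 < d & forall t, c <= t < c + d -> norm2 (z t) < r.
Proof.
move=> acz c0; rewrite -subr_gt0 => zr.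
have c10 : 0 <= c + 1 by rewrite addr_ge0.
have [d d0 Hd] := ac_uniformly_continuous (acz _ c10) zr.
exists (Num.min 1 d); first by rewrite lt_min ltr01.
move=> t /andP[ct]; rewrite -ltrBlDl lt_min => /andP[t1 td].
have : norm2 (z t - z c) < r - norm2 (z c).
  apply: Hd; [by apply/andP; split; lra|by apply/andP; split; lra|].
  by rewrite ger0_norm ?subr_ge0.
by have := ler_norm2B (z t) (z c); lra.
Qed.

(** Two coupled estimates, each of which is only valid inside a region: the
    closed balls that they make invariant lie inside the region, so the curve
    never leaves it. *)
Lemma trapping p q (z : R -> 'rV[R]_p) (e : R -> 'rV[R]_q) (m1 k1 r1 R1 m2 k2 r2 R2 : R) :
  (forall T, 0 <= T -> absolutely_continuous_on 0 T z) ->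
  (forall T, 0 <= T -> absolutely_continuous_on 0 T e) ->
  0 < m1 -> k1 / m1 <= r1 -> norm2 (z 0) <= r1 -> r1 < R1 ->
  0 < m2 -> k2 / m2 <= r2 -> norm2 (e 0) <= r2 -> r2 < R2 ->
  {ae mu, forall t, 0 <= t -> exists2 w, has_velocity z t w & norm2 (e t) < R2 ->
     dot (z t) w <= - m1 * norm2 (z t) ^+ 2 + k1 * norm2 (z t)} ->
  {ae mu, forall t, 0 <= t -> exists2 w, has_velocity e t w &
     norm2 (z t) < R1 -> norm2 (e t) < R2 ->
     dot (e t) w <= - m2 * norm2 (e t) ^+ 2 + k2 * norm2 (e t)} ->
  forall t, 0 <= t -> norm2 (z t) < R1 /\ norm2 (e t) < R2.
Proof.
move=> acz ace m10 km1 z0 rR1 m20 km2 e0 rR2 vz ve.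
apply: continuous_induction => [c c0 Pc|c c0 [zc ec]]; last first.
  have [d d0 Hd] := norm2_lt_right acz c0 zc.
  have [d' d'0 Hd'] := norm2_lt_right ace c0 ec.
  exists (Num.min d d'); first by rewrite lt_min d0.
  move=> t /andP[ct]; rewrite -ltrBlDl lt_min => /andP[td td'].
  by split; [apply: Hd|apply: Hd']; rewrite ct -ltrBlDl.
split.
  apply: le_lt_trans rR1.
  apply: (radial_decay_bound c0 m10 km1 (acz c c0)) z0.
  move: vz; apply: negligibleS => t /= nst st; apply: nst => /andP[t0 tc].
  have [w zw Hw] := st (ltW t0); exists w => //; apply: Hw.
  by have [] := Pc t; first by rewrite (ltW t0).
apply: le_lt_trans rR2.
apply: (radial_decay_bound c0 m20 km2 (ace c c0)) e0.
move: ve; apply: negligibleS => t /= nst st; apply: nst => /andP[t0 tc].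
have [zt et] := Pc t (introT andP (conj (ltW t0) tc)).
by have [w ew Hw] := st (ltW t0); exists w => //; exact: Hw.
Qed.

End Trapping.

Section ErrorRate.
Variables (R : realType) (N r s : nat).
Hypothesis (N_gt0 : (0 < N)%N) (r_gt0 : (0 < r)%N).
Variables (a : 'M[R]_N) (a_weights : weights a) (a_connected : graph_connected a).
Variables (W : 'I_N -> 'M[R]_(r + s)) (upsilon : 'rV[R]_(r + s)) (c : R).
Hypothesis W_lt0 : forall i l, W i l l < 0.
Hypothesis upsilon_pos : forall i : 'I_(r + s), (i < r)%N -> 0 < upsilon 0 i.
Hypothesis upsilon_zero : forall i : 'I_(r + s), (r <= i)%N -> upsilon 0 i = 0.

Let d : 'rV[R]_(r + s) := \row_j maxf (fun i => W i j j).
Let lam := lambda2 (laplacian a *t ulsubmx (diag_mx upsilon)).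
Local Notation m := (m_rate a (diag_mx upsilon) (Wmax W) c).

Lemma diag_blocks (v : 'rV[R]_(r + s)) :
  ulsubmx (diag_mx v) = diag_mx (lsubmx v) /\
  drsubmx (diag_mx v) = diag_mx (rsubmx v).
Proof.
by rewrite -{1 3}(hsubmxK v) diag_mx_row block_mxKul block_mxKdr.
Qed.

Lemma lambda_max_lt0 p (v : 'rV[R]_p) : (0 < p)%N -> (forall j, v 0 j < 0) ->
  lambda_max (diag_mx v) < 0.
Proof.
move=> p0 v0; rewrite lambda_max_diag.
by have [j ->] := maxf_attained (v 0) (Ordinal p0).
Qed.

Lemma Wmax_lt0 j : d 0 j < 0.
Proof.
rewrite mxE; have [i ->] := maxf_attained (fun i => W i j j) (Ordinal N_gt0).
exact: W_lt0.
Qed.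

Lemma lambda_ul_lt0 : lambda_max (ulsubmx (Wmax W)) < 0.
Proof.
rewrite /Wmax -/d (diag_blocks d).1; apply: lambda_max_lt0 => // j.
by rewrite mxE Wmax_lt0.
Qed.

Lemma lambda_dr_lt0 : (0 < s)%N -> lambda_max (drsubmx (Wmax W)) < 0.
Proof.
move=> s0; rewrite /Wmax -/d (diag_blocks d).2; apply: lambda_max_lt0 => // j.
by rewrite mxE Wmax_lt0.
Qed.

(** The coordinates in the first block are damped by the coupling, through the
    algebraic connectivity, the others by the internal dynamics only. *)
Lemma m_rate_le l u : (1 < N)%N -> 0 <= c -> zero_sum u ->
  maxf (fun i => W i l l) * dot u u - c * (upsilon 0 l * dot u (u *m laplacian a))
  <= - m * dot u u.
Proof.
move=> N1 c0 su; have uu := dotxx_ge0 u.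
have -> : maxf (fun i => W i l l) = d 0 l by rewrite mxE.
rewrite /m_rate /Wmax -/d -/lam opprK (diag_blocks d).1 (diag_blocks d).2.
rewrite !lambda_max_diag.
have [l' ll'|l' ll'] := split_ordP l.
  rewrite ll'.
  have dl : d 0 (lshift s l') <= maxf (lsubmx d 0).
    by have := maxf_ge (lsubmx d 0) l'; rewrite mxE.
  have [|_ Hlam] := lambda2_tens_diag a_weights a_connected (d := lsubmx upsilon) N1 r_gt0.
    by move=> k; rewrite mxE upsilon_pos//=.
  have := Hlam l' u su; rewrite mxE -(diag_blocks upsilon).1 -/lam => Hl.
  set mx := if _ then _ else _.
  have mx_ge : maxf (lsubmx d 0) - c * lam <= mx.
    by rewrite /mx; case: ifP => // _; rewrite le_max lexx.
  have : c * (lam * dot u u) <=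
      c * (upsilon 0 (lshift s l') * dot u (u *m laplacian a)) by rewrite ler_wpM2l.
  have : d 0 (lshift s l') * dot u u <= maxf (lsubmx d 0) * dot u u.
    by rewrite ler_wpM2r.
  have : (maxf (lsubmx d 0) - c * lam) * dot u u <= mx * dot u u by rewrite ler_wpM2r.
  by lra.
rewrite ll' upsilon_zero ?leq_addr// mul0r mulr0 subr0 ler_wpM2r//.
have s0 : (0 < s)%N by apply: leq_ltn_trans (ltn_ord l').
rewrite eqn0Ngt s0 /= le_max; apply/orP; right.
by have := maxf_ge (rsubmx d 0) l'; rewrite mxE.
Qed.

(** With a single node the Laplacian is 0 and has no nonzero eigenvalue; [lambda2]
    then takes its default value 0, and the internal rates remain. *)
Lemma m_rate_gt0_single : N = 1%N -> 0 < m.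
Proof.
move=> N1; have lam0 : lam = 0.
  rewrite /lam /lambda2 (_ : laplacian a = 0).
    rewrite tens0mx (_ : [set k | _] = set0) ?inf0//.
    apply/seteqP; split=> // k [/eigenvalueP[v vk v0] k0].
    move: vk; rewrite mulmx0 => /esym/eqP.
    by rewrite scaler_eq0 (negPf k0) (negPf v0).
  apply/matrixP => i j; rewrite !mxE.
  have ord0E (p : 'I_N) : p = 0%N :> nat.
    by apply/eqP; rewrite -leqn0 -ltnS -[X in (_ < X)%N]N1.
  have ij (p q : 'I_N) : p = q by apply/val_inj; rewrite /= !ord0E.
  by rewrite (ij i j) eqxx big1// => k; rewrite (ij k j) eqxx.
rewrite /m_rate -/lam lam0 mulr0 subr0 oppr_gt0.
case: ifPn => [_|]; first exact: lambda_ul_lt0.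
by rewrite -lt0n => s0; rewrite gt_max lambda_ul_lt0 lambda_dr_lt0.
Qed.

(** The two conditions of the theorem, on the gain and on the uncoupled block, say
    that each of the two rates beats the disturbance already at norm emax/2. *)
Lemma m_rate_beats K emax : (1 < N)%N -> 0 < emax ->
  ((0 < s)%N -> - (K / lambda_max (drsubmx (Wmax W))) < emax / 2) ->
  lam^-1 * (2 * K / emax + lambda_max (ulsubmx (Wmax W))) < c ->
  K < emax / 2 * m.
Proof.
move=> N1 e0 HK Hc.
have [|lam0 _] := lambda2_tens_diag a_weights a_connected (d := lsubmx upsilon) N1 r_gt0.
  by move=> k; rewrite mxE upsilon_pos//=.
rewrite -(diag_blocks upsilon).1 -/lam in lam0.
have ul : K < emax / 2 * (- (lambda_max (ulsubmx (Wmax W)) - c * lam)).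
  move: Hc; rewrite mulrC ltr_pdivrMr// => Hc.
  have : 2 * K / emax < c * lam - lambda_max (ulsubmx (Wmax W)) by lra.
  by rewrite ltr_pdivrMr//; lra.
rewrite /m_rate -/lam; case: ifPn => //; rewrite -lt0n => s0.
have dr : K < emax / 2 * (- lambda_max (drsubmx (Wmax W))).
  have := HK s0; rewrite -mulrN -invrN ltr_pdivrMr//.
  by rewrite oppr_gt0 lambda_dr_lt0.
by rewrite maxEle; case: ifP.
Qed.

End ErrorRate.

Lemma error_single (R : realType) (n : nat) (N : nat) (x : 'rV[R]_(N * n)) :
  N = 1%N -> error x = 0.
Proof.
move=> N1; subst N; apply: node_inj => i; have := sum_node_error (ltn0Sn 0) x.
rewrite big_ord1 (ord1 i) => ->.
by apply/rowP => l; rewrite nodeE !mxE.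
Qed.

Theorem theorem3 (R : realType) (N r s : nat) (N_gt0 : (0 < N)%N)
    (r_gt0 : (0 < r)%N)
    (a : 'M[R]_N) (a_weights : weights a) (a_connected : graph_connected a)
    (f h g : 'I_N -> R -> 'rV[R]_(r + s) -> 'rV[R]_(r + s))
    (eta : R -> 'rV[R]_(r + s) -> 'rV[R]_(r + s))
    (W : 'I_N -> 'M[R]_(r + s)) (M : 'I_N -> R) (h0 : R)
    (upsilon : 'rV[R]_(r + s)) (emax delta : R)
    (x0 : 'rV[R]_(N * (r + s))) (hmax c : R)
    (f_regular : forall i, continuous_or_pws (f i))
    (W_diag : forall i, is_diag_mx (W i))
    (W_neg : forall i, negdef (W i))
    (f_quad_affine : forall i,
       quad_affine 1%:M (W i) (f i) (h i) (g i) (M i))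
    (h0_bound : forall i t v, 0 <= t -> filippov (h i) t 0 v -> norm2 v <= h0)
    (eta_regular : continuous_or_pws eta)
    (eta_odd : forall t v, 0 <= t -> eta t (- v) = - eta t v)
    (emax_gt0 : 0 < emax)
    (upsilon_pos : forall i : 'I_(r + s), (i < r)%N -> 0 < upsilon 0 i)
    (upsilon_zero : forall i : 'I_(r + s), (r <= i)%N -> upsilon 0 i = 0)
    (eta_sector : forall t z v, 0 <= t -> norm2 z <= emax ->
       filippov eta t z v ->
       bform (diag_mx upsilon) z z <= bform 1%:M z v)
    (delta_gt0 : 0 < delta) :
  let Upsilon := diag_mx upsilon in
  let Mbar := maxf M in
  let wmax := maxf (fun i => lambda_max (W i)) in
  let eps1 := - (Num.sqrt N%:R * (Mbar + h0) / wmax) in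
  let rmax := Num.max eps1 (norm2 x0) + delta in
  h_sup h rmax = hmax%:E ->
  norm2 (error x0) <= emax / 2 ->
  ((0 < s)%N ->
     - (Num.sqrt N%:R * (Mbar + hmax) / lambda_max (drsubmx (Wmax W)))
     < emax / 2) ->
  c_threshold a Upsilon (Wmax W) Mbar hmax emax < c ->
  let eps2 := Num.sqrt N%:R * (Mbar + hmax) / m_rate a Upsilon (Wmax W) c in
  forall x : R -> 'rV[R]_(N * (r + s)),
    filippov_solution (network f a eta c) x -> x 0 = x0 ->
    bounded_convergence (Num.min eps1 eps2) x.
Proof.
move=> Upsilon Mbar wmax eps1 rmax hsup e0 Hblock Hc eps2 x [acx vx] x0E.
have rs0 : (0 < r + s)%N by rewrite addn_gt0 r_gt0.
have WE i := is_diag_mxE (W_diag i).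
have W_lt0 i l : W i l l < 0.
  have := W_neg i; rewrite WE => /(@negdef_diag_lt0 _ _ _ l).
  by rewrite !mxE eqxx mulr1n.
have wmax_lt0 : wmax < 0.
  rewrite /wmax; have [i ->] := maxf_attained (fun i => lambda_max (W i)) (Ordinal N_gt0).
  by rewrite WE; apply: lambda_max_lt0 => // j; rewrite mxE.
have hmaxP i t z v : 0 <= t -> norm2 z <= rmax -> filippov (h i) t z v ->
    norm2 v <= hmax.
  move=> t0 zr hv; rewrite -lee_fin -hsup; apply: ereal_sup_ubound.
  by exists i, z, t, v.
have Mbar0 : 0 <= Mbar by exact/ltW/(maxM_gt0 N_gt0 rs0 f_quad_affine).
have h_nonempty : filippov (h (Ordinal N_gt0)) 0 0 !=set0.
  exact: (h_filippov_nonempty rs0 f_quad_affine).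
have h00 : 0 <= h0.
  have [v hv] := h_nonempty.
  by apply: le_trans (norm2_ge0 v) _; exact: h0_bound hv.
have k1_ge0 : 0 <= Num.sqrt N%:R * (Mbar + h0) by rewrite mulr_ge0 ?sqrtr_ge0 ?addr_ge0.
have eps1E : eps1 = Num.sqrt N%:R * (Mbar + h0) / (- wmax) by rewrite /eps1 invrN mulrN.
have eps1_ge0 : 0 <= eps1 by rewrite eps1E divr_ge0// oppr_ge0 ltW.
have rmax_ge0 : 0 <= rmax by rewrite addr_ge0 ?(ltW delta_gt0)// le_max eps1_ge0.
have hmax0 : 0 <= hmax.
  have [v hv] := h_nonempty.
  apply: le_trans (norm2_ge0 v) _; apply: hmaxP hv => //.
  by rewrite norm20.
pose K := Num.sqrt N%:R * (Mbar + hmax).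
have K_ge0 : 0 <= K by rewrite mulr_ge0 ?sqrtr_ge0 ?addr_ge0.
pose m := m_rate a Upsilon (Wmax W) c.
(* A single node has no error; both bounds only have to be nonnegative. *)
have [N1|N1] := leqP N 1.
  have {}N1 : N = 1%N by apply/eqP; rewrite eqn_leq N1.
  move=> nu nu0; exists 1 => // t _; rewrite error_single// norm20.
  rewrite addr_ge0 ?(ltW nu0)// le_min eps1_ge0 /= divr_ge0// ltW//.
  exact: (m_rate_gt0_single N_gt0 r_gt0 a upsilon c W_lt0 N1).
move: Hc; rewrite /c_threshold gt_max => /andP[Hc c_gt0].
have c_ge0 := ltW c_gt0.
have Km : K < emax / 2 * m.
  apply: (m_rate_beats N_gt0 r_gt0 a_weights a_connected W_lt0 upsilon_pos N1
    emax_gt0 Hblock).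
  by move: Hc; rewrite /K mulrA.
have m_gt0 : 0 < m.
  by move: (le_lt_trans K_ge0 Km); rewrite pmulr_rgt0// divr_gt0.
have eps2_lt : eps2 <= emax / 2 by rewrite ler_pdivrMr// ltW.
have ups_ge0 l : 0 <= upsilon 0 l.
  have [lr|rl] := ltnP l r; first exact/ltW/upsilon_pos.
  by rewrite upsilon_zero.
have state t v : 0 <= t -> filippov (network f a eta c) t (x t) v ->
    norm2 (error (x t)) < 2 / 3 * emax ->
    dot (x t) v <= - (- wmax) * norm2 (x t) ^+ 2 +
      Num.sqrt N%:R * (Mbar + h0) * norm2 (x t).
  move=> t0 xv ex.
  exact: (state_radial N_gt0 rs0 a_weights f_quad_affine W_diag eta_regular eta_odd
    c_ge0 emax_gt0 ups_ge0 eta_sector t0 (fun i w => h0_bound i t w t0) ex xv).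
have err t v : 0 <= t -> filippov (network f a eta c) t (x t) v ->
    norm2 (x t) < rmax -> norm2 (error (x t)) < 2 / 3 * emax ->
    dot (error (x t)) (error v) <= - m * norm2 (error (x t)) ^+ 2 +
      K * norm2 (error (x t)).
  move=> t0 xv xr ex; rewrite dot_error_error//.
  apply: (error_radial N_gt0 rs0 a_weights f_quad_affine W_diag eta_regular eta_odd
    c_ge0 emax_gt0 eta_sector t0 (fun i z w => @hmaxP i t z w t0) _ xr ex xv).
  by move=> l u; exact: (m_rate_le r_gt0 a_weights a_connected W upsilon_pos
    upsilon_zero l N1 c_ge0).
pose e t := error (x t).
have ace T : 0 <= T -> absolutely_continuous_on 0 T e.
  move=> T0 eps eps0; have [d d0 Hd] := acx T T0 eps eps0.
  exists d => // k u v uv tuv sd; apply: le_lt_trans (Hd k u v uv tuv sd).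
  by apply: ler_sum => j _; rewrite /e -errorB norm2_error_le.
have vel t : 0 <= t -> derivable x t 1 ->
    has_velocity x t (derive1 x t) /\ has_velocity e t (error (derive1 x t)).
  move=> t0 dx; have xw := derivable_has_velocity dx; split => // eps eps0.
  exact: (has_velocity_contraction (@error_linear R N (r + s))
    (norm2_error_le N_gt0) xw).
(* Both estimates hold as long as |x| < rmax and |e| < 2/3 emax, and they keep |x|
   within max(eps1, |x0|) = rmax - delta and |e| within emax/2. *)
have in_region : forall t, 0 <= t -> norm2 (x t) < rmax /\ norm2 (e t) < 2 / 3 * emax.
  apply: (@trapping R _ _ x e (- wmax) (Num.sqrt N%:R * (Mbar + h0))
    (Num.max eps1 (norm2 x0)) rmax m K (emax / 2) (2 / 3 * emax)) => //.
  - by rewrite oppr_gt0.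
  - by rewrite -eps1E le_max lexx.
  - by rewrite x0E le_max lexx orbT.
  - by rewrite ltrDl.
  - by rewrite /e x0E.
  - by lra.
  - move: vx; apply: negligibleS => t /= nst st; apply: nst => t0.
    have [dx xv] := st t0; have [xw _] := vel t t0 dx.
    by exists (derive1 x t) => //; exact: state.
  - move: vx; apply: negligibleS => t /= nst st; apply: nst => t0.
    have [dx xv] := st t0; have [_ ew] := vel t t0 dx.
    by exists (error (derive1 x t)) => //; exact: err.
have lim1 : forall nu, 0 < nu -> exists2 t0, 0 < t0 & forall t, t0 < t ->
    norm2 (x t) <= eps1 + nu.
  rewrite eps1E; apply: radial_decay_limit => //; first by rewrite oppr_gt0.
  move: vx; apply: negligibleS => t /= nst st; apply: nst => t0.
  have [dx xv] := st t0; have [xw _] := vel t t0 dx.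
  have [_ et] := in_region t t0.
  by exists (derive1 x t) => //; exact: state.
have lim2 : forall nu, 0 < nu -> exists2 t0, 0 < t0 & forall t, t0 < t ->
    norm2 (e t) <= eps2 + nu.
  apply: radial_decay_limit => //.
  move: vx; apply: negligibleS => t /= nst st; apply: nst => t0.
  have [dx xv] := st t0; have [_ ew] := vel t t0 dx.
  have [xt et] := in_region t t0.
  by exists (error (derive1 x t)) => //; exact: err.
move=> nu nu0; have [eps12|eps21] := leP eps1 eps2.
  have [t0 t00 Ht] := lim1 nu nu0; exists t0 => // t /Ht.
  exact: le_trans (norm2_error_le N_gt0 (x t)).
exact: lim2.
Qed.
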